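(* Let $G=(V,E)$ be a connected graph with maximum vertex degree at most $4$, and let $\mathcal{T}_1,\ldots,\mathcal{T}_r\subseteq V$ be subsets of vertices (terminals), not necessarily disjoint. Suppose $G$ is $\alpha$-well-linked for $\bigcup_{j=1}^r\mathcal{T}_j$ for some $\alpha<1$, that $|\mathcal{T}_1|=k_1$ and $|\mathcal{T}_j|=k_2$ for all $1<j\le r$, where $k_1,k_2\ge c\, r^2\log r/\alpha$ for a suitable universal constant $c$. Then there is an efficient randomized algorithm that with high probability computes, for each $1\le j\le r$, a subset $\mathcal{T}'_j\subseteq\mathcal{T}_j$ such that the sets $\mathcal{T}'_1,\ldots,\mathcal{T}'_r$ are pairwise disjoint, $|\mathcal{T}'_j|=\Omega(\alpha/r^2)\cdot|\mathcal{T}_j|$ for all $1\le j\le r$, and $G$ is $1$-well-linked for $\bigcup_{j=1}^r\mathcal{T}'_j$.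
   Context: For a graph $G$ and a vertex set $\mathcal{T}$, $G$ is $\alpha$-well-linked for $\mathcal{T}$ iff for every partition $(A,B)$ of $V(G)$, $|E(A,B)|\ge\alpha\cdot\min\{|A\cap\mathcal{T}|,|B\cap\mathcal{T}|\}$. ''With high probability'' means with probability $1-1/\mathrm{poly}(n)$. *)

(* Defs.v *)
From HB Require Import structures.
From mathcomp Require Import all_boot all_order all_algebra.
From mathcomp Require Import reals exp.

Set Implicit Arguments.
Unset Strict Implicit.
Unset Printing Implicit Defensive.

Import Order.TTheory GRing.Theory Num.Theory.
Local Open Scope ring_scope.

(* A finite simple graph on V is a symmetric irreflexive e : rel V. *)

Definition simple_graph (V : finType) (e : rel V) : Prop :=
  symmetric e /\ irreflexive e.

(* The graph with no vertex is not connected. *)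
Definition connected_graph (V : finType) (e : rel V) : Prop :=
  (0 < #|V|)%N /\ forall x y : V, connect e x y.

Definition degree (V : finType) (e : rel V) (x : V) : nat := #|[set y | e x y]|.

(* For disjoint A and B, every edge between them is counted exactly once, as
   the pair whose first component is its endpoint in A. *)
Definition edges_between (V : finType) (e : rel V) (A B : {set V}) :
    {set V * V} :=
  [set xy | [&& xy.1 \in A, xy.2 \in B & e xy.1 xy.2]].

Definition well_linked (R : realType) (V : finType) (e : rel V) (alpha : R)
    (T : {set V}) : bool :=
  [forall A : {set V},
     alpha * (minn #|A :&: T| #|~: A :&: T|)%:R
       <= #|edges_between e A (~: A)|%:R].

(* Randomized algorithms are programs of a random access machine with addition
   and truncated subtraction (but no multiplication), and fair coin flips.  The
   memory consists of arrays of natural numbers, named by numbers: s k i is the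
   i-th cell of the array k.  One step of the machine performs one command;
   since the expressions occurring in a fixed program have bounded size and
   there is no multiplication, polynomial time on this machine is polynomial
   time on a probabilistic Turing machine. *)

Definition store := nat -> nat -> nat.

Inductive expr : Type :=
| Const of nat
| Cell of nat & expr          (* Cell k a : content of k at index a *)
| Plus of expr & expr
| Minus of expr & expr.

Inductive com : Type :=
| Skip
| Assign of nat & expr & expr (* Assign k a b : k[a] := b *)
| Flip of nat & expr          (* Flip k a : k[a] := a fair random bit *)
| Seq of com & com
| Cond of expr & com & com    (* a test succeeds when its value is nonzero *)
| While of expr & com.

Fixpoint eval (s : store) (a : expr) : nat :=
  match a with
  | Const m => m
  | Cell k b => s k (eval s b)
  | Plus b c => (eval s b + eval s c)%N
  | Minus b c => (eval s b - eval s c)%N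
  end.

Definition update (s : store) (k i v : nat) : store :=
  fun k' i' => if (k' == k) && (i' == i) then v else s k' i'.

(* The commands still to be executed, the store, the coins not yet flipped. *)
Record config : Type :=
  Config { todo : seq com; memory : store; coins : seq bool }.

Definition step (g : config) : config :=
  let: Config K s w := g in
  match K with
  | [::] => g
  | Skip :: K' => Config K' s w
  | Assign k a b :: K' => Config K' (update s k (eval s a) (eval s b)) w
  | Flip k a :: K' =>
      Config K' (update s k (eval s a) (nat_of_bool (head false w))) (behead w)
  | Seq c1 c2 :: K' => Config [:: c1, c2 & K'] s w
  | Cond a c1 c2 :: K' =>
      Config ((if eval s a != 0%N then c1 else c2) :: K') s w
  | While a c :: K' =>
      Config (if eval s a != 0%N then [:: c, While a c & K'] else K') s w
  end.

(* The input is stored in the array 0; every other cell initially holds 0. *)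
Definition init_store (input : seq nat) : store :=
  fun k i => if k == 0%N then nth 0%N input i else 0%N.

(* The first t steps flip at most t coins, so t coins suffice. *)
Definition run (c : com) (input : seq nat) (t : nat) (w : t.-tuple bool) :
    config :=
  iter t step (Config [:: c] (init_store input) w).

Definition halted (g : config) : bool := nilp (todo g).

(* The total number of bits of the input. *)
Definition input_size (input : seq nat) : nat :=
  \sum_(x <- input) (trunc_log 2 x).+1.

(* The probability of P under t independent fair coins. *)
Definition coin_prob (R : realType) (t : nat) (P : pred (t.-tuple bool)) : R :=
  #|[set w | P w]|%:R / 2 ^+ t.

(* The input: n, r, numerator and denominator of the rational q, followed by
   the adjacency matrix of e (row by row), and the r characteristic vectors of
   the sets T j.  A machine cannot read a real number alpha: q is a rational
   approximation of it. *)
Definition encode (n r : nat) (e : rel 'I_n) (T : 'I_r -> {set 'I_n})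
    (q : rat) : seq nat :=
  [:: n; r; `|numq q|%N; `|denq q|%N]
  ++ [seq nat_of_bool (e x y) | x <- enum 'I_n, y <- enum 'I_n]
  ++ [seq nat_of_bool (x \in T j) | j <- enum 'I_r, x <- enum 'I_n].

(* The output: the characteristic vectors of the r sets, in the array 1. *)
Definition decode (n r : nat) (g : config) (j : 'I_r) : {set 'I_n} :=
  [set x : 'I_n | memory g 1 (j * n + x)%N != 0%N].
Arguments decode n r g j : clear implicits.

Definition good_output (R : realType) (C alpha : R) (n r : nat) (e : rel 'I_n)
    (T T' : 'I_r -> {set 'I_n}) : bool :=
  [&& [forall j, T' j \subset T j],
      [forall i, forall j, (i != j) ==> [disjoint T' i & T' j]],
      [forall j, C * (alpha / r%:R ^+ 2) * #|T j|%:R <= #|T' j|%:R]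
    & well_linked e (1 : R) (\bigcup_j T' j)].

(* Main.v *)
(* A deterministic algorithm, so the success probability is 1.  Let T be the
   union of the T_j, let m be about 1/alpha, and let d(A) be the number of edges
   leaving A; call A small if it contains at most half of T, so that
   |A & T| <= m d(A).

   1. List all the vertices, each new vertex right after the neighbour that
   discovers it.  An induction shows that the list leaves any set A at most d(A)
   times.  Hence, if any two elements of S are m elements of T apart in the
   list, then |A & S| <= d(A) + |A & T| / m <= 2 d(A) for small A.  Such an S is
   chosen greedily, taking one element from each T_j in turn.

   2. Give capacity 2 to the bridges and 1 to the other edges, and let c(A) be
   the capacity leaving A.  Vertices of S enter X greedily, in turns again, as
   long as each vertex of X can send 3 units of flow and each vertex of S absorb
   1, that is, 3 |A & X| <= c(A) + |A & S| for all A.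

   3. X is 1-well-linked: if A cuts no bridge then c(A) = d(A), and the small one
   of A and its complement, say A, satisfies 3 |A & X| <= d(A) + 2 d(A).
   Otherwise move the small side of a cut bridge across: it has at most one
   vertex of X, and d(A) drops.

   4. If all the vertices of Z, a part of S, are rejected, then |Z| = O(|X|) or
   |S \ Z| = O(|X|), by uncrossing the tight sets that reject them.  Hence, when
   some T_j is exhausted, every other T_i has about as many vertices in X. *)

Require Import Defs.
From HB Require Import structures.
From mathcomp Require Import all_boot all_order all_algebra.
From mathcomp Require Import reals exp.
From mathcomp Require Import zify ring lra.
From Stdlib Require Import FunctionalExtensionality.

Set Implicit Arguments.
Unset Strict Implicit.
Unset Printing Implicit Defensive.

(** * Structured programs *)

(** Why bridges are doubled: call c(A) + |A & S| - 3 |A & X| the slack of A. A rejected vertex z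
    lies in a set of slack at most 2. One unit of it is paid by z itself, which is a sink inside the
    set; the other has to be absorbed by the capacity that leaves the set, and this works once c(A)
    >= 2 for every nonempty proper A. In a connected graph, capacity 2 on the bridges achieves
    exactly this, and it still leaves at most one vertex of X on the small side of a bridge.

    Why turns: rejection only bounds the size of a set by the total number of vertices accepted so
    far, over all r sets. Taking turns makes that total at most about r times the share of each
    single set. Each of the two selections loses one factor r in this way, and the spacing m loses
    the factor 1/alpha.

    Flows serve only to find, for each rejected vertex, the set that rejects it; every estimate is a
    statement about cuts. All selections are made in natural numbers, with q in place of alpha. *)

Inductive prg : Type :=
| PSkip
| PAssign of nat & expr & expr
| PSeq of prg & prg
| PIf of expr & prg & prg
| PFor of nat & nat & prg.   (* PFor i b p : for i[0] from 0 to 0[b] - 1 do p *)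

Fixpoint compile (p : prg) : com :=
  match p with
  | PSkip => Skip
  | PAssign k a b => Assign k a b
  | PSeq p q => Seq (compile p) (compile q)
  | PIf a p q => Cond a (compile p) (compile q)
  | PFor i b p =>
      Seq (Assign i (Const 0) (Const 0))
        (While (Minus (Cell 0 (Const b)) (Cell i (Const 0)))
           (Seq (compile p)
              (Assign i (Const 0) (Plus (Cell i (Const 0)) (Const 1)))))
  end.

Fixpoint writes (p : prg) : seq nat :=
  match p with
  | PSkip => [::]
  | PAssign k _ _ => [:: k]
  | PSeq p q | PIf _ p q => writes p ++ writes q
  | PFor i _ p => i :: writes p
  end.

(** Array 0, the input, is never written, so the bound of a loop (cell 0 or 1 of it: n or r) is
    constant, and no body touches the counter of its own loop. This makes the compiled [While] agree
    with the bounded iteration in [den]. *)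
Fixpoint wf (p : prg) : bool :=
  match p with
  | PSkip => true
  | PAssign k _ _ => k != 0
  | PSeq p q | PIf _ p q => wf p && wf q
  | PFor i b p => [&& i != 0, (b < 2), i \notin writes p & wf p]
  end.

Definition incr (i : nat) (s : store) : store := update s i 0 (s i 0 + 1).

Fixpoint den (p : prg) (s : store) : store :=
  match p with
  | PSkip => s
  | PAssign k a b => update s k (eval s a) (eval s b)
  | PSeq p q => den q (den p s)
  | PIf a p q => if eval s a != 0 then den p s else den q s
  | PFor i b p => iter (s 0 b) (fun s => incr i (den p s)) (update s i 0 0)
  end.

Lemma update_other s k i v k' : k' != k -> update s k i v k' = s k'.
Proof.
by move=> /negPf kk'; apply: functional_extensionality => j; rewrite /update kk'.
Qed.

Lemma den_frame p s k : k \notin writes p -> den p s k = s k.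
Proof.
elim: p s => [|l a b|p IHp q IHq|a p IHp q IHq|i b p IHp] s /=.
- by [].
- by rewrite inE => /update_other.
- by rewrite mem_cat negb_or => /andP[/IHp hp /IHq ->].
- by rewrite mem_cat negb_or => /andP[/IHp hp /IHq hq]; case: ifP.
- rewrite inE negb_or => /andP[ki /IHp hp].
  elim: (s 0 b) => [|N IHN] /=; first by rewrite update_other.
  by rewrite /incr update_other // hp.
Qed.

Lemma wf_writes0 p : wf p -> 0 \notin writes p.
Proof.
elim: p => [|l a b|p IHp q IHq|a p IHp q IHq|i b p IHp] /=.
- by [].
- by rewrite inE eq_sym.
- by rewrite mem_cat negb_or => /andP[/IHp -> /IHq ->].
- by rewrite mem_cat negb_or => /andP[/IHp -> /IHq ->].
- by case/and4P=> i0 _ _ /IHp h; rewrite inE negb_or eq_sym i0.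
Qed.

(* Iterations are counted from the invariant's first argument; the invariant
   may not mention the loop counter, which holds [k] when the body starts. *)
Lemma for_rule (Inv : nat -> store -> Prop) i b p s N :
  wf (PFor i b p) -> s 0 b = N -> Inv 0 s ->
  (forall k s v, Inv k s -> Inv k (update s i 0 v)) ->
  (forall k s, k < N -> s i 0 = k -> s 0 b = N -> Inv k s -> Inv k.+1 (den p s)) ->
  Inv N (den (PFor i b p) s).
Proof.
move=> /= /and4P[i0 _ iw wp] sb I0 stab body.
have b0 := wf_writes0 wp.
rewrite sb; set F := fun s => incr i (den p s).
suff H k : k <= N -> let s' := iter k F (update s i 0 0) in
    [/\ Inv k s', s' i 0 = k & s' 0 b = N].
  by case: (H N (leqnn N)).
elim: k => [|k IHk] kN /=.
  split; first exact: stab.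
    by rewrite /update !eqxx.
  by rewrite update_other // eq_sym.
have [Ik ik bk] := IHk (ltnW kN).
split.
- by apply: stab; apply: body.
- by rewrite /F /incr /update !eqxx /= (den_frame _ iw) ik addn1.
- by rewrite /F /incr update_other 1?eq_sym // (den_frame _ b0).
Qed.

(** Each loop costs 3 steps of its own (sequencing, initialisation, the last, failing test), and
    each pass 3 more (test, sequencing, increment). *)
Fixpoint time (p : prg) (N : nat) : nat :=
  match p with
  | PSkip | PAssign _ _ _ => 1
  | PSeq p q | PIf _ p q => 1 + time p N + time q N
  | PFor _ _ p => 3 + N * (3 + time p N)
  end.

Lemma time_poly p : exists P : {poly nat}, forall N, P.[N]%R = time p N.
Proof.
elim: p => [|l a b|p [P HP] q [Q HQ]|a p [P HP] q [Q HQ]|i b p [P HP]] /=.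
- by exists 1%R => N; rewrite hornerC.
- by exists 1%R => N; rewrite hornerC.
- by exists (1 + P + Q)%R => N; rewrite !hornerD hornerC HP HQ.
- by exists (1 + P + Q)%R => N; rewrite !hornerD hornerC HP HQ.
- by exists (3%:P + 'X * (3%:P + P))%R => N;
    rewrite !hornerD hornerM hornerX hornerD !hornerC HP.
Qed.

Lemma compileP p s w K N :
  wf p -> (forall b, b < 2 -> s 0 b <= N) ->
  exists2 t, t <= time p N &
    iter t step (Config (compile p :: K) s w) = Config K (den p s) w.
Proof.
elim: p s w K => [|l a b|p IHp q IHq|a p IHp q IHq|i b p IHp] s w K.
- by move=> _ _; exists 1.
- by move=> _ _; exists 1.
- move=> /= /andP[wp wq] sN.
  have [t1 t1le e1] := IHp s w (compile q :: K) wp sN.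
  have sN' c : c < 2 -> den p s 0 c <= N.
    by rewrite (den_frame _ (wf_writes0 wp)); apply: sN.
  have [t2 t2le e2] := IHq (den p s) w K wq sN'.
  exists (t2 + (t1 + 1)).
    by lia.
  by rewrite !iterD /= e1.
- move=> /= /andP[wp wq] sN.
  case: ifP => ha.
    have [t1 t1le e1] := IHp s w K wp sN.
    exists (t1 + 1); first by lia.
    by rewrite iterD /= ha.
  have [t1 t1le e1] := IHq s w K wq sN.
  exists (t1 + 1); first by lia.
  by rewrite iterD /= ha.
- move=> /= /and4P[i0 b2 iw wp] sN.
  have b0 := wf_writes0 wp.
  set F := fun s => incr i (den p s); set W := While _ _.
  set s0 := update s i 0 0.
  have inv k : k <= s 0 b -> let s' := iter k F s0 in
      s' i 0 = k /\ s' 0 = s 0.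
    elim: k => [|k IHk] kN /=.
      by rewrite /s0 {1}/update !eqxx update_other // eq_sym.
    have [ik zk] := IHk (ltnW kN).
    split; first by rewrite /F /incr /update !eqxx /= (den_frame _ iw) ik addn1.
    by rewrite /F /incr update_other 1?eq_sym // (den_frame _ b0).
  have loop k : k <= s 0 b -> exists2 t, (t <= k * (3 + time p N)) &
      iter t step (Config (W :: K) s0 w) = Config (W :: K) (iter k F s0) w.
    elim: k => [|k IHk] kN; first by exists 0.
    have [t tle et] := IHk (ltnW kN).
    have [ik zk] := inv _ (ltnW kN).
    have sN' c : c < 2 -> iter k F s0 0 c <= N by rewrite zk; apply: sN.
    have [t1 t1le e1] := IHp (iter k F s0) w
        (Assign i (Const 0) (Plus (Cell i (Const 0)) (Const 1)) :: W :: K) wp sN'.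
    exists (1 + (t1 + (2 + t))); first by rewrite mulSn; lia.
    rewrite iterD iterD iterD et /=.
    rewrite ik zk.
    have -> /= : (s 0 b - k != 0) by lia.
    by rewrite e1 /=.
  have [t tle et] := loop _ (leqnn _).
  have [ik zk] := inv _ (leqnn (s 0 b)).
  exists (1 + (t + 2)).
    have := leq_mul (sN _ b2) (leqnn (3 + time p N)).
    by lia.
  rewrite iterD iterD /= -/W -/s0 et /=.
  by rewrite ik zk subnn.
Qed.

(** A configuration with nothing left to do is a fixed point of [step], so surplus steps are
    harmless. *)
Lemma run_compile p input N t (w : t.-tuple bool) :
  wf p -> (forall b, b < 2 -> nth 0 input b <= N) -> time p N <= t ->
  run (compile p) input w = Config [::] (den p (init_store input)) w.
Proof.
move=> wp iN tN; rewrite /run.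
have [t1 t1le e1] := @compileP p (init_store input) w [::] N wp iN.
move: (tval w) e1 => v e1.
rewrite -(subnK (leq_trans t1le tN)) iterD e1.
by elim: (t - t1) => //= k ->.
Qed.

(** * Cuts and well-linkedness *)

Section Weights.
Variable V : finType.
Implicit Types (c : V -> V -> nat) (A B C U : {set V}).

(** With 0/1 factors under a sum over all pairs, submodularity and its relatives reduce to a case
    check of the memberships of one pair. *)
Definition weight c A B : nat :=
  \sum_(xy : V * V) (xy.1 \in A) * (xy.2 \in B) * c xy.1 xy.2.

Definition cut c A : nat := weight c A (~: A).

Lemma card_edges_between (e : rel V) A B :
  #|edges_between e A B| = weight (fun x y => e x y) A B.
Proof.
rewrite -sum1_card big_mkcond; apply: eq_bigr => -[x y] _; rewrite inE /=.
by case: (x \in A); case: (y \in B); case: (e x y).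
Qed.

Lemma leq_weight c c' A B :
  (forall x y, x \in A -> y \in B -> c x y <= c' x y) ->
  weight c A B <= weight c' A B.
Proof.
move=> cc'; apply: leq_sum => -[x y] _ /=.
case: (boolP (x \in A)) => // xA; case: (boolP (y \in B)) => // yB.
by rewrite !mul1n cc'.
Qed.

Lemma eq_weight c c' A B :
  (forall x y, x \in A -> y \in B -> c x y = c' x y) ->
  weight c A B = weight c' A B.
Proof.
by move=> cc'; apply/eqP; rewrite eqn_leq !leq_weight // => x y xA yB; rewrite cc'.
Qed.

Lemma weight_setUl c A B C : [disjoint A & B] ->
  weight c (A :|: B) C = weight c A C + weight c B C.
Proof.
move=> AB; rewrite /weight -big_split; apply: eq_bigr => -[x y] _ /=.
rewrite inE; case: (boolP (x \in A)) => xA; last by [].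
by rewrite (disjointFr AB xA) /= addn0.
Qed.

Lemma weight_sym c A B : (forall x y, c x y = c y x) -> weight c A B = weight c B A.
Proof.
move=> sc; rewrite /weight (reindex_inj (h := fun xy => (xy.2, xy.1))) /=; last first.
  by move=> [x y] [x' y'] /= [-> ->].
by apply: eq_bigr => -[x y] _ /=; rewrite sc [X in X * _]mulnC.
Qed.

Lemma weight_subr c A B C : B \subset C -> weight c A B <= weight c A C.
Proof.
move=> /subsetP BC; apply: leq_sum => -[x y] _ /=.
case: (boolP (y \in B)) => [/BC ->|_] //; by rewrite muln0.
Qed.

Lemma cut_submod c A B : cut c (A :|: B) + cut c (A :&: B) <= cut c A + cut c B.
Proof.
rewrite /cut /weight -!big_split; apply: leq_sum => -[x y] _ /=.
rewrite !inE -!mulnDl.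
by case: (x \in A); case: (x \in B); case: (y \in A); case: (y \in B).
Qed.

Lemma cut_setC c A : (forall x y, c x y = c y x) -> cut c (~: A) = cut c A.
Proof. by move=> sc; rewrite /cut setCK weight_sym. Qed.

Lemma cut_disjointU c A B : (forall x y, c x y = c y x) -> [disjoint A & B] ->
  cut c (A :|: B) + 2 * weight c A B = cut c A + cut c B.
Proof.
move=> sc AB; rewrite mul2n -addnn {2}(weight_sym _ _ sc).
rewrite /cut /weight -!big_split; apply: eq_bigr => -[x y] _ /=.
rewrite !inE -!mulnDl; congr (_ * _).
case: (boolP (x \in A)) => xA; case: (boolP (y \in A)) => yA;
  rewrite ?(disjointFr AB xA) ?(disjointFr AB yA) //=;
  by case: (x \in B); case: (y \in B).
Qed.

End Weights.

(** * From flow conditions to 1-well-linkedness *)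

Section Boosting.
Variables (V : finType) (e : rel V).
Hypotheses (e_sym : symmetric e) (e_irr : irreflexive e).
Hypothesis e_conn : forall x y : V, connect e x y.

Let ew (x y : V) : nat := e x y.

Lemma cut_gt0 (A : {set V}) : A != set0 -> A != setT -> 0 < cut ew A.
Proof.
move=> /set0Pn[x xA] /eqP AT.
rewrite lt0n; apply/eqP => c0; apply: AT; apply/setP => y; rewrite inE.
have /connectP[p] := e_conn x y.
elim: p x xA => [|z p IHp] x xA /=; first by move=> _ ->.
case/andP=> exz pz lz; apply: (IHp z) => //.
apply/negPn/negP => zA; move/eqP: c0; rewrite /cut /weight sum_nat_eq0.
by move=> /forallP /(_ (x, z)) /=; rewrite inE xA zA /ew exz.
Qed.

Variable c : V -> V -> nat.
Hypothesis c_sym : forall x y, c x y = c y x.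
Hypothesis c_bound : forall x y, e x y <= c x y <= 2 * e x y.
Hypothesis c_bridge : forall x y, c x y = 2 ->
  exists2 D : {set V}, x \in D /\ y \notin D & cut ew D = 1.
Hypothesis c_nonbridge : forall x y, c x y = 1 ->
  forall D : {set V}, x \in D -> y \notin D -> 1 < cut ew D.

Lemma cut_le_cutc A : cut ew A <= cut c A.
Proof. by apply: leq_weight => x y _ _; case/andP: (c_bound x y). Qed.

Lemma cutc_le A : cut c A <= 2 * cut ew A.
Proof.
rewrite /cut /weight big_distrr; apply: leq_sum => -[x y] _ /=.
rewrite mulnCA leq_mul2l; by case/andP: (c_bound x y) => _ ->; rewrite orbT.
Qed.

Lemma cut_edge (A : {set V}) : 0 < cut ew A -> exists x y, [/\ x \in A, y \notin A & e x y].
Proof.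
rewrite lt0n /cut /weight sum_nat_eq0 => /forallPn[[x y]] /=.
rewrite !muln_eq0 !negb_or !inE !eqb0 !negbK => /andP[/andP[xA yA] exy].
by exists x, y.
Qed.

(** A cut edge of capacity 2 is enough by itself; a cut edge of capacity 1 is no bridge, so a second
    edge leaves the set. *)
Lemma cutc_gt1 (A : {set V}) : A != set0 -> A != setT -> 1 < cut c A.
Proof.
move=> A0 AT; have c0 := cut_gt0 A0 AT.
have [x [y [xA yA exy]]] := cut_edge c0.
have := c_bound x y; rewrite exy => cxy.
have [c2|c1] : c x y = 2 \/ c x y = 1 by lia.
  rewrite /cut /weight (bigD1 (x, y)) //= inE xA yA c2.
  exact: leq_addr.
by apply: leq_trans (cut_le_cutc A); apply: c_nonbridge c1 _ xA yA.
Qed.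

Lemma cut1_unique (D : {set V}) x y x' y' : cut ew D = 1 -> x \in D -> y \notin D -> e x y ->
  x' \in D -> y' \notin D -> e x' y' -> (x', y') = (x, y).
Proof.
move=> D1 xD yD exy xD' yD' exy'; apply/eqP/negPn/negP => ne.
move: D1; rewrite /cut /weight (bigD1 (x, y)) //= (bigD1 (x', y')) //=.
by rewrite !inE xD yD xD' yD' /ew exy exy' !mul1n addnA.
Qed.

Variables (S X : {set V}).
Hypothesis S_half : forall A,
  (#|A :&: S| <= 2 * cut ew A) || (#|~: A :&: S| <= 2 * cut ew A).
Hypothesis X_flow : forall A, 3 * #|A :&: X| <= cut c A + #|A :&: S|.

Lemma ew_sym x y : ew x y = ew y x. Proof. by rewrite /ew e_sym. Qed.

(** The only edge leaving [D] ends at [o], inside [A]. So every edge leaving [A :|: D] already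
    leaves [A], and the edge from [o] to [p] no longer does. *)
Lemma cut_setU_bridge (A D : {set V}) o p : cut ew D = 1 -> p \in D -> o \notin D -> e p o ->
  o \in A -> p \notin A -> cut ew (A :|: D) < cut ew A.
Proof.
move=> D1 pD oD epo oA pA.
rewrite [X in _ < X]/cut /weight (bigD1 (o, p)) //= !inE oA pA /ew e_sym epo mul1n.
rewrite add1n ltnS /cut /weight [X in _ <= X]big_mkcond; apply: leq_sum => -[x y] _ /=.
rewrite !inE negb_or.
case: (boolP (y \in A)) => yA /=; first by rewrite muln0.
case: (boolP (y \in D)) => yD /=; first by rewrite muln0.
case: (boolP (e x y)) => exy; last by rewrite muln0.
case: (boolP (x \in D)) => xD /=.
  have [_ ey] := cut1_unique D1 pD oD epo xD yD exy.
  by rewrite ey oA in yA.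
by case: eqP => [[_ ey]|_]; [rewrite ey pD in yD|rewrite orbF].
Qed.

(** Capacity at most 2 and at most 2 sinks: three times the left side is at most 4. *)
Lemma small_side D : cut ew D = 1 -> #|D :&: S| <= 2 -> #|D :&: X| <= 1.
Proof.
by move=> D1 DS; have := X_flow D; have := cutc_le D; lia.
Qed.

(* Moving the small side of a cut bridge across loses one edge of the cut and
   at most one vertex of X; when no bridge is cut, [c] and [e] agree. *)
Lemma linked_of_flow A : minn #|A :&: X| #|~: A :&: X| <= cut ew A.
Proof.
have [N] := ubnP (cut ew A); elim: N A => // N IHN A AN.
have IHU A' D o p : cut ew A' = cut ew A -> cut ew D = 1 -> #|D :&: S| <= 2 ->
    p \in D -> o \notin D -> e p o -> o \in A' -> p \notin A' ->
    minn #|A' :&: X| #|~: A' :&: X| <= cut ew A'.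
  move=> AA' D1 DS pD oD epo oA pA.
  have lt := cut_setU_bridge D1 pD oD epo oA pA.
  have := IHN (A' :|: D); have := small_side D1 DS.
  have : #|A' :&: X| <= #|(A' :|: D) :&: X|.
    by apply: subset_leq_card; rewrite setSI // subsetUl.
  have : #|~: A' :&: X| <= #|~: (A' :|: D) :&: X| + #|D :&: X|.
    apply: leq_trans (leq_card_setU _ _); apply: subset_leq_card.
    apply/subsetP => z; rewrite !inE => /andP[/negPf-> ->].
    by rewrite !andbT /=; case: (z \in D).
  lia.
case: (boolP [exists x, exists y, [&& x \in A, y \notin A & c x y == 2]]).
  case/existsP => x /existsP[y /and3P[xA yA /eqP c2]].
  have exy : e x y by have := c_bound x y; rewrite c2; case: (e x y).
  have [D [xD yD] D1] := c_bridge c2.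
  have D1' : cut ew (~: D) = 1 by rewrite cut_setC //; exact: ew_sym.
  have := S_half D; rewrite D1 => /orP[DS|DS].
    (* The small side [D] contains the end of the bridge that is in [A], so it is moved out of [A],
       that is, into [~: A]. *)
    have := @IHU (~: A) D y x; rewrite !cut_setC; try exact: ew_sym.
    by rewrite setCK !inE yA xA negbK minnC; apply.
  have := @IHU A (~: D) x y; rewrite !inE yD xD e_sym negbK; exact.
move=> nb; have cA : cut c A = cut ew A.
  apply: eq_weight => x y xA yA; apply/eqP; move: yA; rewrite inE => yA.
  have := c_bound x y; rewrite /ew; case exy: (e x y); last by lia.
  move=> cb; apply: contraNT nb => c1; apply/existsP; exists x.
  by apply/existsP; exists y; rewrite xA yA /=; lia.
have cA' : cut c (~: A) = cut ew A by rewrite cut_setC.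
have := X_flow A; have := X_flow (~: A); rewrite cA cA'.
by case/orP: (S_half A); lia.
Qed.

(** * Uncrossing the sets that reject vertices *)

Section Blocked.
Variable Z : {set V}.
Hypothesis ZS : Z \subset S.
Hypothesis Z_blocked : forall z, z \in Z -> z \notin X ->
  exists2 A : {set V}, z \in A & cut c A + #|A :&: S| <= 3 * #|A :&: X| + 2.

(** [f A] is what [A] can dispose of. The slack [f A - 3 * #|A :&: X|] is nonnegative by [X_flow]
    and submodular. *)
Let f A := cut c A + #|A :&: S|.

Lemma f_submod A B : f (A :|: B) + f (A :&: B) <= f A + f B.
Proof.
rewrite /f; have := cut_submod c A B.
by have := cardsUI (A :&: S) (B :&: S); rewrite -setIUl -setIIl; lia.
Qed.

Lemma cardUI_setI (A B Y : {set V}) :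
  #|(A :|: B) :&: Y| + #|(A :&: B) :&: Y| = #|A :&: Y| + #|B :&: Y|.
Proof. by rewrite setIUl setIIl cardsUI. Qed.

Lemma card_setI_disjointU (A B Y : {set V}) : [disjoint A & B] ->
  #|(A :|: B) :&: Y| = #|A :&: Y| + #|B :&: Y|.
Proof.
move=> /disjoint_setI0 AB; have := cardUI_setI A B Y.
by rewrite AB set0I cards0 addn0.
Qed.

(** Outside a maximal tight set [U], the rejected vertices are covered by disjoint sets [C], each
    with [#|C :&: Z'|] of order [#|C :&: X| + weight c C U]. Both terms are additive over disjoint
    sets, and their totals are of order |X| because [cut c U <= 3 * #|U :&: X|]. *)
Lemma blocked_bound : (#|S| <= #|Z| + 2 + 18 * #|X|) || (#|Z| <= 40 * #|X|).
Proof.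
case: (leqP #|S| (#|Z| + 2 + 18 * #|X|)) => //= Sbig.
pose tight U := f U == 3 * #|U :&: X|.
have tight0 : tight set0.
  rewrite /tight /f !set0I !cards0 /cut /weight big1 // => -[x y] _.
  by rewrite inE.
have [U] := maxset_exists tight0; case/maxsetP => /eqP tU maxU _.
(* By maximality a proper enlargement of [U] has slack at least 1; this unit makes merging
   affordable. *)
have gt1 (C : {set V}) : C != set0 -> [disjoint C & U] -> 3 * #|(U :|: C) :&: X| < f (U :|: C).
  move=> C0 CU; rewrite ltn_neqAle X_flow andbT eq_sym.
  apply/negP => /maxU; rewrite subsetUl => /(_ isT) /setP UC.
  case/set0Pn: C0 => z zC; have := UC z; rewrite inE zC orbT => zU.
  by rewrite (disjointFr CU zC) in zU.
pose Z' := Z :\: (U :|: X).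
(* [G] consists of rejected vertices in [C]. They are sinks, hence counted in [f], and pay for all
   of the slack but 1, however many sets have been merged into [C]. *)
pose good (C : {set V}) := [&& C != set0, [disjoint C & U] &
  [exists G : {set V}, (G \subset C :&: Z') &&
    (f (U :|: C) <= 3 * #|(U :|: C) :&: X| + #|G| + 1)]].
have good1 z : z \in Z' -> exists2 C : {set V}, z \in C & [disjoint C & U] /\
    f (U :|: C) <= 3 * #|(U :|: C) :&: X| + 2.
  rewrite !inE negb_or => /andP[/andP[zU zX] zZ].
  have [A zA hA] := Z_blocked zZ zX.
  exists (A :\: U); first by rewrite inE zU.
  split; first by rewrite -setI_eq0 setDE -setIA [~: U :&: U]setIC setICr setI0.
  have -> : U :|: A :\: U = U :|: A.
    by apply/setP => x; rewrite !inE; case: (x \in U).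
  have := f_submod U A; have xf : 3 * #|U :&: A :&: X| <= f (U :&: A) := X_flow _; have := cardUI_setI U A X.
  by rewrite -/(f A) in hA; move: hA tU xf; clear; lia.
have goodS z (C : {set V}) : z \in Z' -> z \in C -> [disjoint C & U] ->
    f (U :|: C) <= 3 * #|(U :|: C) :&: X| + 2 -> good C.
  move=> zZ zC CU fC; apply/and3P; split=> //; first by apply/set0Pn; exists z.
  apply/existsP; exists [set z]; rewrite cards1 sub1set inE zC zZ /=.
  by apply: leq_trans fC _; rewrite -addnA.
(* Slack [#|G| + 1] and slack 2, less the unit owed to the intersection, give [#|G| + 2]; the new
   vertex [z] of [G] pays for the increase. *)
have merge (C D : {set V}) z : good C -> z \in Z' -> z \notin C -> z \in D ->
    [disjoint D & U] -> f (U :|: D) <= 3 * #|(U :|: D) :&: X| + 2 ->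
    C :&: D != set0 -> good (C :|: D).
  case/and3P=> C0 CU /existsP[G /andP[/subsetP GC fC]] zZ zC zD DU fD CD.
  have CDU : [disjoint C :|: D & U].
    rewrite -setI_eq0 setIUl; move: CU DU; rewrite -!setI_eq0.
    by move=> /eqP-> /eqP->; rewrite setU0.
  apply/and3P; split=> //.
    by case/set0Pn: C0 => x xC; apply/set0Pn; exists x; rewrite inE xC.
  apply/existsP; exists (z |: G); apply/andP; split.
    apply/subsetP => x; rewrite !inE => /orP[/eqP->|/GC].
      by rewrite zD orbT /=; move: zZ; rewrite !inE.
    by rewrite !inE => /andP[-> ->].
  have zG : z \notin G by apply: contra zC => /GC; rewrite inE => /andP[].
  have CIU : [disjoint C :&: D & U].
    by apply: disjointWl CU; apply: subsetIl.
  have := gt1 _ CD CIU; have := f_submod (U :|: C) (U :|: D).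
  rewrite -setUIr setUACA setUid cardsU1 zG.
  have := cardUI_setI (U :|: C) (U :|: D) X; rewrite -setUIr setUACA setUid.
  move: fC fD; clear; lia.
have local (C : {set V}) : good C -> #|C :&: Z'| <= 4 * (3 * #|C :&: X| + 2 * weight c C U).
  case/and3P=> C0 CU /existsP[G /andP[GC fC]].
  have SZ : #|G| + #|C :&: (S :\: Z)| <= #|C :&: S|.
    rewrite -cardsUI (_ : G :&: _ = set0) ?cards0 ?addn0; last first.
      apply/setP => x; rewrite !inE; apply/negP.
      by case/andP=> /(subsetP GC); rewrite !inE => /and3P[_ _ ->]; rewrite andbF.
    apply: subset_leq_card; apply/subsetP => x; rewrite !inE => /orP[/(subsetP GC)|].
      by rewrite !inE => /and3P[-> _ /(subsetP ZS)].
    by case/and3P=> -> _ ->.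
  (* Subtract the equation of the tight [U]. The capacity between [C] and [U] disappears from both
     cuts, hence the factor 2; [G] cancels against the sinks in [C]. *)
  have key : cut c C + #|C :&: (S :\: Z)| <= 1 + 3 * #|C :&: X| + 2 * weight c C U.
    have := cut_disjointU c_sym CU; rewrite [C :|: U]setUC.
    have UC : [disjoint U & C] by rewrite disjoint_sym.
    move: fC tU SZ; rewrite /f !(card_setI_disjointU _ UC); clear; lia.
  have wU : weight c C U <= cut c U.
    rewrite (weight_sym _ _ c_sym) /cut; apply: weight_subr.
    by apply/subsetP => x xC; rewrite inE (disjointFr CU xC).
  have XCU : #|C :&: X| + #|U :&: X| <= #|X|.
    rewrite -card_setI_disjointU //; apply: subset_leq_card; exact: subsetIr.
  have ZC : #|C :&: Z'| <= #|C :&: S|.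
    apply: subset_leq_card; apply/subsetP => x; rewrite !inE.
    by case/and3P=> -> _ /(subsetP ZS).
  have cl := cut_le_cutc C.
  case/orP: (S_half C) => hS.
    have [CT|CT] := eqVneq C setT.
      suff : cut ew C = 0 by move: ZC hS; clear; lia.
      rewrite CT /cut /weight big1 // => -[x y] _; by rewrite !inE.
    (* Write K for [3 * #|C :&: X| + 2 * weight c C U]. As the cut is at least 2, [cut c C <= 1 + K]
       becomes [cut c C <= 2 * K]. A surviving additive 1 would bring the number of sets [C] into
       the total. *)
    have := cutc_gt1 C0 CT; move: cl hS ZC key; clear; lia.
  (* In the other case few sinks lie outside [C], so [S :\: Z] has at most 2 + 2 K elements, with K
     at most 6 |X|, against [Sbig]. *)
  have : #|S :\: Z| <= #|C :&: (S :\: Z)| + #|~: C :&: S|.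
    rewrite -(cardsID C (S :\: Z)) setIC leq_add2l; apply: subset_leq_card.
    by apply/subsetP => x; rewrite !inE => /and3P[-> _ ->].
  have : #|S| <= #|S :\: Z| + #|Z|.
    by rewrite -(cardsID Z S) addnC leq_add2l subset_leq_card // subsetIr.
  move: tU hS cl key wU XCU Sbig; rewrite /f; clear; lia.
(* [W] is the union of the sets split off so far. The next one is a maximal good set disjoint from
   [W]: the candidate set of a vertex outside it cannot meet it, since merging would enlarge it. So
   the hypothesis passes to the larger union. *)
have glob (W : {set V}) :
    (forall z, z \in Z' -> z \notin W -> exists2 C : {set V}, z \in C &
       [/\ [disjoint C & U], f (U :|: C) <= 3 * #|(U :|: C) :&: X| + 2 &
       [disjoint C & W]]) ->
    [disjoint W & U] ->
    #|Z' :\: W| + 4 * (3 * #|W :&: X| + 2 * weight c W U)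
      <= 4 * (3 * #|X :\: U| + 2 * cut c U).
  have [N] := ubnP #|~: W|; elim: N W => // N IHN W WN hW WU.
  have wW : 4 * (3 * #|W :&: X| + 2 * weight c W U)
      <= 4 * (3 * #|X :\: U| + 2 * cut c U).
    have : #|W :&: X| <= #|X :\: U|.
      apply: subset_leq_card; apply/subsetP => x; rewrite !inE.
      by case/andP=> xW ->; rewrite (disjointFr WU xW).
    have : weight c W U <= cut c U.
      rewrite (weight_sym _ _ c_sym) /cut; apply: weight_subr.
      by apply/subsetP => x xW; rewrite inE (disjointFr WU xW).
    clear; lia.
  have [->|] := eqVneq (Z' :\: W) set0; first by rewrite cards0 add0n.
  case/set0Pn=> z; rewrite inE => /andP[zW zZ].
  have [C0 zC0 [C0U fC0 C0W]] := hW z zZ zW.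
  pose P C := good C && [disjoint C & W].
  have PC0 : P C0 by rewrite /P C0W andbT (goodS z).
  have [C] := maxset_exists PC0; case/maxsetP => /andP[gC CW] maxC C0C.
  have CU : [disjoint C & U] by case/and3P: gC.
  have WC : [disjoint W & C] by rewrite disjoint_sym.
  have := IHN (W :|: C); rewrite (weight_setUl _ _ WC) (card_setI_disjointU _ WC).
  have zC : z \in C := subsetP C0C _ zC0.
  have -> : #|~: (W :|: C)| < N.
    rewrite -ltnS (leq_trans _ WN) // ltnS; apply: proper_card.
    apply/properP; split; first by rewrite setCS subsetUl.
    by exists z; rewrite !inE ?zC ?orbT.
  have : #|Z' :\: W| <= #|Z' :\: (W :|: C)| + #|C :&: Z'|.
    apply: leq_trans (leq_card_setU _ _); apply: subset_leq_card.
    apply/subsetP => x; rewrite !inE => /andP[/negPf-> /andP[-> ->]].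
    by case: (x \in C).
  have := local _ gC.
  move=> h1 h2 /(_ isT) h3; have : #|Z' :\: (W :|: C)| +
     4 * (3 * (#|W :&: X| + #|C :&: X|) + 2 * (weight c W U + weight c C U)) <=
     4 * (3 * #|X :\: U| + 2 * cut c U); last by move: h1 h2; clear; lia.
  apply: h3; last first.
    rewrite -setI_eq0 setIUl; move: CU WU; rewrite -!setI_eq0.
    by move=> /eqP-> /eqP->; rewrite setU0.
  move=> y yZ; rewrite inE negb_or => /andP[yW yC].
  have [D yD [DU fD DW]] := hW y yZ yW.
  exists D => //; split=> //.
  have CD0 : C :&: D = set0.
    apply/eqP/negPn/negP => CD.
    have PD : P (C :|: D).
      rewrite /P (merge _ _ y) //= -setI_eq0 setIUl.
      move: CW DW; rewrite -!setI_eq0.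
      by move=> /eqP-> /eqP->; rewrite setU0.
    have := maxC _ PD (subsetUl _ _) => /setP /(_ y).
    by rewrite inE yD orbT (negPf yC).
  rewrite -setI_eq0 setIUr [D :&: C]setIC CD0 setU0.
  by rewrite setI_eq0.
have := glob set0; rewrite setD0 set0I cards0.
have Z'le : #|Z| <= #|Z'| + #|U :&: S| + #|X|.
  rewrite -(cardsID (U :|: X) Z) addnC -addnA leq_add2l.
  apply: leq_trans (leq_card_setU _ _); apply: subset_leq_card.
  apply/subsetP => x; rewrite !inE => /andP[/(subsetP ZS)-> /orP[]->] //.
  by rewrite orbT.
have XU : #|U :&: X| + #|X :\: U| = #|X| by rewrite setIC cardsID.
move=> G0; have : #|Z'| + 4 * (3 * 0 + 2 * weight c set0 U) <=
    4 * (3 * #|X :\: U| + 2 * cut c U).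
  apply: G0; last by rewrite -setI_eq0 set0I.
  move=> z zZ _; have [C zC [CU fC]] := good1 z zZ.
  exists C => //; split=> //; by rewrite -setI_eq0 setI0.
(* As [U] is tight, [8 * cut c U + #|U :&: S|] is at most [24 * #|U :&: X|]. *)
move: tU Z'le XU; rewrite /f; clear; lia.
Qed.

End Blocked.

End Boosting.

(** * Orderings with few exits *)

Section Exits.
Variable V : finType.
Implicit Types (A S T : {set V}) (x : V) (p q : seq V).

Fixpoint exits A x p : nat :=
  if p is y :: p' then (x \in A) && (y \notin A) + exits A y p' else 0.

Lemma exits_cat A x p q : exits A x (p ++ q) = exits A x p + exits A (last x p) q.
Proof. by elim: p x => //= y p IHp x; rewrite IHp addnA. Qed.

(** If [w] is on the same side of [A] as its predecessor, nothing changes; otherwise at most one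
    exit is new, to be charged to the edge that discovers [w]. *)
Lemma exits_insert A x p w q :
  exits A x (p ++ w :: q)
    <= exits A x (p ++ q) + ((last x p \in A) != (w \in A)).
Proof.
rewrite !exits_cat -addnA leq_add2l; case: q => [|y q] /=.
  by case: (last x p \in A); case: (w \in A).
by case: (last x p \in A); case: (w \in A); case: (y \in A) => /=; lia.
Qed.

Lemma edges_between_insert (e : rel V) A (W : {set V}) v w :
  symmetric e -> v \in W -> w \notin W -> e v w ->
  #|edges_between e (A :&: W) (W :\: A)| + ((v \in A) != (w \in A))
    <= #|edges_between e (A :&: (w |: W)) ((w |: W) :\: A)|.
Proof.
move=> es vW wW evw; set E := edges_between _ _ _; set E' := edges_between _ _ _.
have EE' : E \subset E'.
  apply/subsetP => -[x y]; rewrite !inE /=.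
  by case/and3P=> /andP[-> ->] /andP[-> ->] ->; rewrite !orbT.
case: (boolP (v \in A)) => vA; case: (boolP (w \in A)) => wA;
  rewrite ?addn0 ?(subset_leq_card EE') //= addn1; apply: proper_card;
  apply/properP; split=> //.
- by exists (v, w); rewrite !inE /= ?vA ?vW ?wA ?eqxx ?orbT ?evw //= ?(negPf wW) ?andbF /= ?andbF.
- by exists (w, v); rewrite !inE /= ?vA ?vW ?wA ?eqxx ?orbT 1?es ?evw //= ?(negPf wW) ?andbF /= ?andbF.
Qed.

Variables (S T : {set V}) (m : nat).

Definition lead q : nat := count (mem T) (take (find (mem S) q) q).

(** An element of [S] is itself the first of its m terminals, hence the successor. The last one
    needs m - 1 further terminals too, as the end of the list is no exit. *)
Fixpoint spaced q : bool :=
  if q is x :: p then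
    ((x \in S) ==> (x \in T) && (m <= (lead p).+1)) && spaced p
  else true.

Lemma lead_cons x p :
  lead (x :: p) = if x \in S then 0 else (x \in T) + lead p.
Proof. by rewrite /lead /=; case: ifP. Qed.

(* The [lead q] terminals before the first element of [S] are kept in reserve:
   they pay for an element of [S] put in front of [q]. *)
Lemma spaced_exits A x p : spaced (x :: p) ->
  m * count (mem (A :&: S)) (x :: p) + (if x \in A then minn m (lead (x :: p)) else 0)
    <= m * exits A x p + count (mem (A :&: T)) (x :: p).
Proof.
elim: p x => [|y p IHp] x /=.
  rewrite /lead /= !inE; case: (x \in A) => /=; last by rewrite !muln0.
  by case: (x \in S); case xT: (x \in T); rewrite /= ?xT; lia.
case/andP => hx sp; have {IHp} := IHp y sp.
rewrite [lead (x :: _)]lead_cons ![count _ (y :: p)]/= !inE.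
move: hx; case: (x \in A) => /=; last first.
  by move=> _; case: (y \in A); lia.
case: (x \in S) => /=; last first.
  by move=> _; case: (y \in A); case: (x \in T) => /=; lia.
case/andP=> -> /= mle; case: (y \in A); lia.
Qed.

Variable L : seq V.
Definition rank (v : V) : nat := count (mem T) (take (index v L) L).

Lemma rank_lt x y : x \in T -> x \in L -> index x L < index y L -> rank x < rank y.
Proof.
move=> xT xL ixy; have ix : index x L < size L by rewrite index_mem.
rewrite /rank -(cat_take_drop (index x L).+1 (take (index y L) L)) take_takel //.
rewrite count_cat (take_nth x ix) -cats1 count_cat (nth_index x xL).
by apply: leq_trans (leq_addr _ _); rewrite -addn1 leq_add2l /= addn0 lt0b.
Qed.

Lemma rank_lt_count x : x \in T -> x \in L -> rank x < count (mem T) L.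
Proof.
move=> xT xL; have ix : index x L < size L by rewrite index_mem.
rewrite /rank -[X in _ < count _ X](cat_take_drop (index x L).+1 L).
rewrite count_cat (take_nth x ix) -cats1 count_cat (nth_index x xL).
by apply: leq_trans (leq_addr _ _); rewrite -addn1 leq_add2l /= addn0 lt0b.
Qed.

Lemma rank_inj : (forall x, x \in L) -> {in T &, injective rank}.
Proof.
move=> all x y xT yT rxy.
case: (ltngtP (index x L) (index y L)) => [h|h|h].
- by have := rank_lt xT (all x) h; rewrite rxy ltnn.
- by have := rank_lt yT (all y) h; rewrite rxy ltnn.
by rewrite -(nth_index x (all x)) h nth_index.
Qed.

(** Passes from conditions on ranks, which the machine can test, to the recursive form that the
    induction along the list uses. *)
Lemma spaced_rank : uniq L -> S \subset T ->
  (forall x, x \in S -> rank x + m <= count (mem T) L) ->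
  {in S &, forall x y, x != y -> (rank x + m <= rank y) || (rank y + m <= rank x)} ->
  spaced L.
Proof.
move=> uL ST Send Sgap.
suff H q p : L = q ++ p -> spaced p by apply: (H [::]).
elim: p q => //= x p IHp q defL; apply/andP; split; last first.
  by apply: (IHp (rcons q x)); rewrite cat_rcons.
apply/implyP => xS; have xT := subsetP ST _ xS; rewrite xT /=.
have uq : uniq (q ++ x :: p) by rewrite -defL.
have xq : x \notin q.
  by move: uq; rewrite cat_uniq => /and3P[_ /norP[/= ? _] _].
have rx : rank x = count (mem T) q.
  by rewrite /rank defL index_cat (negPf xq) /= eqxx addn0 take_size_cat.
case: (boolP (has (mem S) p)) => hS; last first.
  rewrite /lead hasNfind // take_size; have := Send x xS.
  rewrite rx defL count_cat /= xT; lia.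
set i := find (mem S) p; have ip : i < size p by rewrite -has_find.
pose y := nth x p i; have yS : y \in S by apply: (nth_find x hS).
have yp : y \in p by apply: mem_nth.
have [yq yx] : y \notin q /\ y != x.
  move: uq; rewrite cat_uniq /= => /and3P[_ /norP[_ /hasPn/(_ y yp) yq] /andP[xp _]].
  by split=> //; apply: contraNneq xp => <-.
have up : uniq p by move: uq; rewrite cat_uniq /= => /and3P[_ _ /andP[_]].
have ry : rank y = count (mem T) q + (lead p).+1.
  rewrite /rank {1}defL index_cat (negPf yq) /= [x == y]eq_sym (negPf yx) index_uniq //.
  rewrite defL takeD take_size_cat // drop_size_cat // count_cat.
  have -> : count (mem T) (take i.+1 (x :: p)) = (x \in T) + count (mem T) (take i p) by [].
  by rewrite xT.
have xy : x != y by rewrite eq_sym.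
have := Sgap x y xS yS xy; rewrite rx ry; move: (lead p) (count _ q) => a b.
by clear; lia.
Qed.

End Exits.

(** * Counting the vertices rejected by the spacing *)

Section Gap.
Variables (V : finType) (T S : {set V}) (rk : V -> nat) (m tot : nat).
Hypothesis rk_inj : {in T &, injective rk}.

Lemma card_rank_interval a l (Y : {set V}) : Y \subset T ->
  (forall x, x \in Y -> a <= rk x < a + l) -> #|Y| <= l.
Proof.
move=> /subsetP YT hY; rewrite cardE -(size_map rk) -(size_iota a l).
apply: uniq_leq_size; last first.
  move=> _ /mapP[x xY ->]; rewrite mem_iota; apply: hY; by rewrite mem_enum in xY.
rewrite map_inj_in_uniq ?enum_uniq // => x y; rewrite !mem_enum => /YT xT /YT yT.
exact: rk_inj.
Qed.

(** Ranks are injective, so each element of [S] is close to at most 2 m terminals, and at most m lie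
    too near the end. *)
Lemma card_close (Y : {set V}) : Y \subset T ->
  (forall x, x \in Y -> rk x < tot) ->
  (forall x, x \in Y -> (tot < rk x + m) \/
     exists2 y, y \in S & rk x < rk y + m /\ rk y < rk x + m) ->
  #|Y| <= m + 2 * m * #|S|.
Proof.
move=> YT Ylt hY.
pose B y := [set x in Y | (rk x < rk y + m) && (rk y < rk x + m)].
have Bsub y : B y \subset T.
  by apply: subset_trans YT; apply/subsetP => x; rewrite inE => /andP[].
have Bc y : #|B y| <= 2 * m.
  apply: (@card_rank_interval ((rk y).+1 - m)) => // x.
  rewrite inE => /andP[_]; lia.
pose B0 := [set x in Y | tot < rk x + m].
have B0c : #|B0| <= m.
  apply: (@card_rank_interval (tot - m)).
    by apply: subset_trans YT; apply/subsetP => x; rewrite inE => /andP[].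
  move=> x; rewrite inE => /andP[/Ylt]; lia.
have : Y \subset B0 :|: \bigcup_(y in S) B y.
  apply/subsetP => x xY; rewrite !inE xY /=.
  case: (hY x xY) => [->//|[y yS [h1 h2]]]; apply/orP; right.
  by apply/bigcupP; exists y => //; rewrite inE xY h1 h2.
move/subset_leq_card/leq_trans; apply; apply: leq_trans (leq_card_setU _ _) _.
apply: leq_add => //; rewrite mulnC -sum_nat_const.
elim/big_rec2: _ => [|y n A _ An]; first by rewrite cards0.
by apply: leq_trans (leq_card_setU _ _) _; apply: leq_add.
Qed.

End Gap.

(** * Residual networks *)

Section Flow.
Variable V : finType.
Implicit Types (c R : V -> V -> nat) (A S : {set V}) (y sk : V -> nat).

Definition residual c S (y : {set V} -> nat) R sk : Prop :=
  forall A, cut c A + #|A :&: S| = cut R A + y A + \sum_(x in A) sk x.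

Lemma cut_push R R' u v A : u != v -> 0 < R u v ->
  R' u v = (R u v).-1 -> R' v u = (R v u).+1 ->
  (forall x z, (x, z) != (u, v) -> (x, z) != (v, u) -> R' x z = R x z) ->
  cut R' A + (u \in A) = cut R A + (v \in A).
Proof.
move=> uv Ruv R'uv R'vu R'R; rewrite /cut /weight.
have vu : (v, u) != (u, v) by rewrite xpair_eqE negb_and eq_sym uv.
rewrite (bigD1 (u, v)) //= (bigD1 (v, u)) //=.
rewrite [in RHS](bigD1 (u, v)) //= [in RHS](bigD1 (v, u)) //=.
have -> : \sum_(xy | (xy != (u, v)) && (xy != (v, u)))
    (xy.1 \in A) * (xy.2 \in ~: A) * R' xy.1 xy.2 =
  \sum_(xy | (xy != (u, v)) && (xy != (v, u)))
    (xy.1 \in A) * (xy.2 \in ~: A) * R xy.1 xy.2.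
  by apply: eq_bigr => -[x z] /andP[h1 h2] /=; rewrite R'R.
rewrite R'uv R'vu !inE; case: (u \in A); case: (v \in A) => /=; lia.
Qed.

End Flow.

(** * Graph search *)

Definition scal (k : nat) : expr := Cell k (Const 0).
Definition pset (k : nat) (a : expr) : prg := PAssign k (Const 0) a.
Definition entry (k : nat) (a b : expr) : expr := Cell k (Plus (Cell 3 a) b).
Definition pseq : seq prg -> prg := foldr PSeq PSkip.
Definition pif (a : expr) (ps : seq prg) : prg := PIf a (pseq ps) PSkip.
Definition pifnot (a : expr) (ps : seq prg) : prg := PIf a PSkip (pseq ps).

Lemma den_pseq q qs s : den (pseq (q :: qs)) s = den (pseq qs) (den q s).
Proof. by []. Qed.

Lemma den_pseq0 s : den (pseq [::]) s = s.
Proof. by []. Qed.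

Lemma den_pif a ps s :
  den (pif a ps) s = if eval s a != 0 then den (pseq ps) s else s.
Proof. by []. Qed.

Lemma den_pifnot a ps s :
  den (pifnot a ps) s = if eval s a != 0 then s else den (pseq ps) s.
Proof. by []. Qed.

Lemma den_pifnot_true a ps s : eval s a != 0 -> den (pifnot a ps) s = s.
Proof. by rewrite den_pifnot => ->. Qed.

Lemma den_pifnot_false a ps s : eval s a = 0 -> den (pifnot a ps) s = den (pseq ps) s.
Proof. by rewrite den_pifnot => ->. Qed.

(* Arrays: 2 matrix, 3 row offsets, 4 visiting time, 5 parent, 6 successor in
   the list of visited vertices; cells 22 number of visited vertices, 23 root *)
Definition search : prg :=
  pseq [::
    PFor 32 0 (PAssign 4 (scal 32) (Const 0));
    PAssign 4 (scal 23) (Const 1);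
    pset 22 (Const 1);
    PFor 30 0 (PFor 31 0 (PFor 32 0
      (pif (Cell 4 (scal 31)) [:: pifnot (Cell 4 (scal 32)) [::
        pif (entry 2 (scal 31) (scal 32)) [::
          pset 22 (Plus (scal 22) (Const 1));
          PAssign 4 (scal 32) (scal 22);
          PAssign 5 (scal 32) (scal 31);
          PAssign 6 (scal 32) (Cell 6 (scal 31));
          PAssign 6 (scal 31) (scal 32) ]]])))].

Lemma path_ext (T : eqType) (e e' : rel T) x p :
  (forall a, a \in belast x p -> forall b, e a b -> e' a b) ->
  path e x p -> path e' x p.
Proof.
elim: p x => //= y p IHp x h /andP[exy py]; apply/andP; split.
  by apply: h exy; rewrite mem_head.
by apply: IHp py => a ap; apply: h; rewrite in_cons ap orbT.
Qed.

Section Search.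
Variable n : nat.
Implicit Types (R vis par nxt : nat -> nat) (x : 'I_n) (p L : seq 'I_n).

Definition entries R (u v : 'I_n) : nat := R (u * n + v).

Definition sym_support R : rel 'I_n :=
  fun u v => (0 < entries R u v) || (0 < entries R v u).

(** [vis] is a visiting time, 0 meaning unvisited. Parents have smaller times, so chains of parents
    end at the root. [R] may be a residual matrix and asymmetric, hence exits are compared with its
    symmetric support. *)
Record searched R vis par nxt cnt x p : Prop := Searched {
  sr_uniq : uniq (x :: p);
  sr_cnt : cnt = (size p).+1;
  sr_vis : forall v : 'I_n, (0 < vis v) = (v \in x :: p);
  sr_vis_le : forall v : 'I_n, vis v <= cnt;
  sr_nxt : path (fun a b : 'I_n => nxt a == b) x p;
  sr_par : forall v : 'I_n, v \in p -> exists u : 'I_n,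
    [/\ par v = u, u \in x :: p, vis u < vis v & 0 < entries R u v];
  sr_exits : forall A : {set 'I_n}, exits A x p <=
    #|edges_between (sym_support R) (A :&: [set v in x :: p]) ([set v in x :: p] :\: A)|
}.

Definition closed_under R L : Prop :=
  forall u v : 'I_n, u \in L -> 0 < entries R u v -> v \in L.

Lemma searched_init R vis par nxt x :
  (forall v : 'I_n, vis v = (v == x)) -> searched R vis par nxt 1 x [::].
Proof.
move=> hvis; split=> //.
- by move=> v; rewrite hvis inE lt0b.
- by move=> v; rewrite hvis; case: eqP.
Qed.

Lemma searched_insert R vis par nxt vis' par' nxt' cnt x p (u v : 'I_n) :
  searched R vis par nxt cnt x p -> u \in x :: p -> v \notin x :: p ->
  0 < entries R u v ->
  (forall z : 'I_n, vis' z = if z == v then cnt.+1 else vis z) ->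
  (forall z : 'I_n, par' z = if z == v then nat_of_ord u else par z) ->
  (forall z : 'I_n, nxt' z = if z == u then nat_of_ord v
                             else if z == v then nxt u else nxt z) ->
  exists2 p', perm_eq p' (v :: p) & searched R vis' par' nxt' cnt.+1 x p'.
Proof.
move=> [un ct vi vl nx pa ex] uL vL Ruv hvis hpar hnxt.
have [p1 [p2 [defp lastu]]] : exists p1 p2, p = p1 ++ p2 /\ last x p1 = u.
  by case/splitPl: uL => p1 p2 lu; exists p1, p2.
have pe : perm_eq (p1 ++ v :: p2) (v :: p) by rewrite defp perm_catC /= perm_cons perm_catC.
have mem' z : (z \in x :: p1 ++ v :: p2) = (z == v) || (z \in x :: p).
  by rewrite in_cons (perm_mem pe) !in_cons orbCA.
exists (p1 ++ v :: p2) => //; split.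
- rewrite (perm_uniq (s2 := v :: x :: p)) ?cons_uniq ?vL //.
  by apply/permP => a /=; rewrite (permP pe a) /= addnCA.
- by rewrite ct (perm_size pe).
- by move=> z; rewrite hvis mem' -vi; case: eqP.
- by move=> z; rewrite hvis; case: eqP => // _; apply: leqW.
- move: nx; rewrite defp !cat_path /= lastu => /andP[nx1 nx2].
  have := un; rewrite defp -cat_cons lastI lastu cat_rcons cat_uniq => /and3P[_ hb ub].
  have {hb} ub1 : u \notin belast x p1.
    by apply: contra hb => h; apply/hasP; exists u => //; exact: mem_head.
  apply/and3P; split.
  + apply: path_ext nx1 => a ab b /=; rewrite hnxt.
    case: (a =P u) => [au|_]; first by rewrite -au ab in ub1.
    case: (a =P v) => // av; case/negP: vL; rewrite -av defp -cat_cons lastI cat_rcons.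
    by rewrite mem_cat ab.
  + by rewrite hnxt eqxx.
  + case: p2 defp nx2 ub pe mem' => //= y p3 defp /andP[uy nx2] /andP[up3 _] pe mem'.
    rewrite hnxt; case: (v =P u) => [uv|_]; first by rewrite uv uL in vL.
    rewrite eqxx uy; apply: path_ext nx2 => a /mem_belast ap3 b /=; rewrite hnxt.
    case: (a =P u) => [au|_]; first by rewrite -au ap3 in up3.
    case: (a =P v) => // av; case/negP: vL; rewrite -av defp in_cons mem_cat.
    by rewrite ap3 !orbT.
- move=> z; rewrite (perm_mem pe) in_cons => /orP[/eqP->|zp].
    exists u; rewrite hpar eqxx mem' uL orbT; split=> //.
    rewrite !hvis eqxx; case: eqP => [uv|_]; last by rewrite ltnS.
    by rewrite -uv uL in vL.
  have zv : z != v by apply: contraNneq vL => <-; rewrite in_cons zp orbT.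
  have [w [h1 h2 h3 h4]] := pa z zp; exists w.
  rewrite hpar !hvis mem' h2 orbT (negPf zv); split=> //.
  by case: eqP => // wv; rewrite -wv h2 in vL.
- move=> A; apply: leq_trans (exits_insert _ _ _ _ _) _; rewrite lastu -defp.
  have -> : [set z in x :: p1 ++ v :: p2] = v |: [set z in x :: p].
    by apply/setP => z; rewrite !inE -!in_cons mem' !inE.
  apply: (leq_trans _ (@edges_between_insert _ (sym_support R) A _ u v _ _ _ _)).
  + by rewrite leq_add2r ex.
  + by move=> a b; rewrite /sym_support orbC.
  + by rewrite inE.
  + by rewrite inE.
  + by rewrite /sym_support Ruv.
Qed.
Definition visit : prg :=
  pif (Cell 4 (scal 31)) [:: pifnot (Cell 4 (scal 32)) [::
    pif (entry 2 (scal 31) (scal 32)) [::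
      pset 22 (Plus (scal 22) (Const 1));
      PAssign 4 (scal 32) (scal 22);
      PAssign 5 (scal 32) (scal 31);
      PAssign 6 (scal 32) (Cell 6 (scal 31));
      PAssign 6 (scal 31) (scal 32) ]]].

Let searching (s : store) x p := searched (s 2) (s 4) (s 5) (s 6) (s 22 0) x p.

Lemma visitP (s : store) x p (u v : 'I_n) : s 3 u = u * n -> s 31 0 = u -> s 32 0 = v ->
  searching s x p ->
  let s' := den visit s in
  (searching s' x p /\
     (u \in x :: p -> 0 < entries (s' 2) u v -> v \in x :: p)) \/
  exists2 p', perm_eq p' (v :: p) &
    [/\ u \in x :: p, 0 < entries (s 2) u v, v \notin x :: p & searching s' x p'].
Proof.
move=> ho hu hv sp; have vis := sr_vis sp.
rewrite /visit /= hu -lt0n vis.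
case: (boolP (u \in x :: p)) => up /=; last by left.
rewrite hv -lt0n vis.
case: (boolP (v \in x :: p)) => vp /=; first by left.
rewrite ho; case: ifP => Ruv /=; last by left; split=> //; rewrite /entries lt0n Ruv.
right; rewrite -lt0n in Ruv; set s' := (X in searching X).
suff [p' pp' sp'] : exists2 p', perm_eq p' (v :: p) & searching s' x p' by exists p'.
have -> : searching s' x = searched (s' 2) (s' 4) (s' 5) (s' 6) (s 22 0).+1 x.
  by rewrite /searching /s' /update /= addn1.
apply: (searched_insert sp up vp Ruv) => z; rewrite /s' /update /= ?hv ?hu.
- by rewrite -val_eqE /=; case: ifP; rewrite // addn1.
- by rewrite -val_eqE.
- by rewrite -!val_eqE /=; case: ifP.
Qed.

Lemma searchP (s : store) x :
  s 0 0 = n -> s 23 0 = x -> (forall u : 'I_n, s 3 u = u * n) ->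
  let s' := den search s in
  exists p, searched (s 2) (s' 4) (s' 5) (s' 6) (s' 22 0) x p /\
            closed_under (s 2) (x :: p).
Proof.
move=> s0 st so.
set s1 := den (PFor 32 0 (PAssign 4 (scal 32) (Const 0))) s.
set s2 := den (pset 22 (Const 1)) (den (PAssign 4 (scal 23) (Const 1)) s1).
have -> : den search s = den (PFor 30 0 (PFor 31 0 (PFor 32 0 visit))) s2 by [].
have s1vis : forall v, v < n -> s1 4 v = 0.
  apply: (for_rule (Inv := fun k s => forall v, v < k -> s 4 v = 0)) => //.
  move=> k t kn i2 _ IH v; rewrite ltnS leq_eqVlt => vk.
  rewrite /= /update /= i2; case: eqP => // vk'; apply: IH.
  by case/orP: vk => // /eqP.
have fr k : k \notin [:: 32; 4] -> s1 k = s k by move=> h; apply: den_frame.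
have s2i : searching s2 x [::].
  have s22 : s2 22 0 = 1 by [].
  rewrite /searching s22; apply: searched_init => v.
  rewrite /s2 /= /update /= fr // st -val_eqE /=.
  by case: eqP => // _; rewrite s1vis.
have fr2 k : k \notin [:: 32; 4; 22] -> s2 k = s k.
  rewrite !inE !negb_or => /and3P[h1 h2 h3].
  by rewrite /s2 /= !update_other // fr // !inE negb_or h1 h2.
have {s2i} [p [P1 P2 P3]] : exists p, [/\ searching (den (PFor 30 0 (PFor 31 0 (PFor 32 0 visit))) s2) x p,
   closed_under (s 2) (x :: p) & True].
  pose base (t : store) := t 2 = s 2 /\ t 3 = s 3.
  (* A round over all pairs that finds nothing proves closure, so every other round adds a vertex; n
     rounds suffice. *)
  pose outer a (t : store) := base t /\ exists p, searching t x p /\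
     (a < size (x :: p) \/ closed_under (s 2) (x :: p)).
  suff : outer n (den (PFor 30 0 (PFor 31 0 (PFor 32 0 visit))) s2).
    case=> _ [p [sp [szp|cl]]]; exists p => //.
    have := uniq_leq_size (sr_uniq sp) (fun v _ => mem_enum 'I_n v).
    by rewrite -cardE card_ord leqNgt szp.
  (* Until the round finds a new vertex the list is unchanged, so the rows already scanned remain
     checked. *)
  pose mid a k (t : store) := base t /\ exists p, searching t x p /\
     [\/ a.+1 < size (x :: p), closed_under (s 2) (x :: p) |
      a < size (x :: p) /\ forall u v : 'I_n, u < k -> u \in x :: p ->
         0 < entries (s 2) u v -> v \in x :: p].
  pose inner a k l (t : store) := base t /\ exists p, searching t x p /\
     [\/ a.+1 < size (x :: p), closed_under (s 2) (x :: p) |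
      a < size (x :: p) /\ forall u v : 'I_n, (u < k) || (u == k :> nat) && (v < l) ->
        u \in x :: p -> 0 < entries (s 2) u v -> v \in x :: p].
  apply: (for_rule (Inv := outer)) => //.
  - by rewrite fr2.
  - split; first by split; rewrite fr2.
    by exists [::]; split=> //; left.
  move=> a t an ia ta [bt [p [sp hp]]].
  suff : mid a n (den (PFor 31 0 (PFor 32 0 visit)) t).
    case=> bt' [p' [sp' hp']]; split=> //; exists p'; split=> //.
    case: hp' => [h|h|[h1 h2]]; [by left|by right|right].
    by move=> u v; apply: h2.
  apply: (for_rule (Inv := mid a)) => //.
  - split=> //; exists p; split=> //.
    by case: hp => h; [apply: Or33|apply: Or32].
  move=> k t1 kn ik t10 [bt1 [p1 [sp1 hp1]]].
  suff : inner a k n (den (PFor 32 0 visit) t1).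
    case=> bt' [p' [sp' hp']]; split=> //; exists p'; split=> //.
    case: hp' => [h|h|[h1 h2]]; [by apply: Or31|by apply: Or32|apply: Or33].
    split=> // u v; rewrite ltnS leq_eqVlt orbC => uk; apply: h2.
    by rewrite ltn_ord andbT.
  suff : inner a k n (den (PFor 32 0 visit) t1) /\ True by case.
  pose inner' l (t : store) := inner a k l t /\ t 31 0 = k.
  suff : inner' n (den (PFor 32 0 visit) t1) by case.
  apply: (for_rule (Inv := inner')) => //.
  - split=> //; split=> //; exists p1; split=> //.
    case: hp1 => [h|h|[h1 h2]]; [by apply: Or31|by apply: Or32|apply: Or33].
    by split=> // u v; rewrite ltn0 andbF orbF; apply: h2.
  move=> l t2 ln il t20 [[bt2 [p2 [sp2 hp2]]] kt2].
  have := @visitP t2 x p2 (Ordinal kn) (Ordinal ln) _ kt2 il sp2.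
  have fv i : i \notin [:: 22; 4; 5; 6] -> den visit t2 i = t2 i.
    by move=> h; apply: den_frame; move: h; rewrite /= !inE !negb_or; case/and4P=> -> -> -> ->.
  rewrite /inner' /inner /base !fv // bt2.1 bt2.2 so => /(_ (erefl _)); cbv zeta.
  case=> [[sp' h]|[p' pp' [uin Rin vnin sp']]].
    split=> //; split=> //; exists p2; split=> //.
    case: hp2 => [h0|h0|[h1 h2]]; [by apply: Or31|by apply: Or32|apply: Or33].
    split=> // u v uv; case: (altP (u =P Ordinal kn)) => [uk|uk].
      case: (altP (v =P Ordinal ln)) => [vl|vl]; first by rewrite uk vl.
      apply: h2; move: uv; rewrite ltnS [v <= l]leq_eqVlt.
      by move: vl; rewrite -val_eqE /= => /negPf->.
    have uk2 : u != k :> nat := uk.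
    by apply: h2; move: uv uk2; clear; lia.
  split=> //; split=> //; exists p'; split=> //.
  rewrite /= (perm_size pp') /=.
  case: hp2 => [h0|h0|[h1 h2]]; apply: Or31.
  - by apply: leq_trans h0 _.
  - by case/negP: vnin; apply: h0 Rin.
  - by [].
exists p; split=> //; move: P1; rewrite /searching.
have -> : den (PFor 30 0 (PFor 31 0 (PFor 32 0 visit))) s2 2 = s 2; last by [].
by rewrite den_frame // fr2.
Qed.

End Search.

(** * Augmenting paths *)

Definition differ (a b : expr) : expr := Plus (Minus a b) (Minus b a).

Definition push : prg :=
  pif (differ (scal 24) (scal 23)) [::
    pset 16 (Cell 5 (scal 24));
    PAssign 2 (Plus (Cell 3 (scal 16)) (scal 24))
      (Minus (entry 2 (scal 16) (scal 24)) (Const 1));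
    PAssign 2 (Plus (Cell 3 (scal 24)) (scal 16))
      (Plus (entry 2 (scal 24) (scal 16)) (Const 1));
    pset 24 (scal 16)].

(* Array 9 holds the capacities left at the sinks; cell 29 counts successes. *)
Definition augment : prg :=
  pseq [:: search; pset 28 (Const 0);
    PFor 33 0 (pif (Cell 4 (scal 33)) [:: pif (Cell 9 (scal 33)) [::
      pset 28 (Plus (scal 33) (Const 1)) ]]);
    pif (scal 28) [::
      pset 24 (Minus (scal 28) (Const 1));
      PAssign 9 (scal 24) (Minus (Cell 9 (scal 24)) (Const 1));
      pset 29 (Plus (scal 29) (Const 1));
      PFor 33 0 push ]].

Lemma pair_index_eq n (u u' v v' : 'I_n) :
  (u * n + v == u' * n + v') = ((u, v) == (u', v')).
Proof.
apply/eqP/eqP => [h|[-> ->]] //.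
have n0 : 0 < n := leq_ltn_trans (leq0n v) (ltn_ord v).
have hv : v = v' :> nat by move: (congr1 (modn^~ n) h); rewrite !modnMDl !modn_small.
congr (_, _); apply: val_inj => //=.
move: (congr1 (divn^~ n) h); rewrite !divnMDl // !divn_small // !addn0; exact.
Qed.

Section Augment.
Variable n : nat.
Variables (c : 'I_n -> 'I_n -> nat) (S : {set 'I_n}).
Implicit Types (y : {set 'I_n} -> nat) (s : store) (x : 'I_n).

Definition flow_at s y : Prop :=
  residual c S y (entries (s 2)) (fun v : 'I_n => s 9 v).

(** The unit is laid backwards from the sink: it currently starts at [v], and a push on the edge
    from the parent [u] makes it start at [u]. Only the two entries of this pair change, so the tree
    edges into vertices no later than [u] remain usable. *)
Lemma pushP s x p y (v : 'I_n) vis cnt :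
  (forall u : 'I_n, s 3 u = u * n) -> s 23 0 = x -> s 24 0 = v -> v != x ->
  v \in x :: p ->
  (forall w : 'I_n, w \in p -> exists u : 'I_n,
     [/\ s 5 w = u, u \in x :: p, vis u < vis w & vis w <= cnt]) ->
  (forall w u : 'I_n, w \in p -> s 5 w = u -> vis w <= vis v ->
     0 < entries (s 2) u w) ->
  flow_at s (fun A => y A + (v \in A)) ->
  let s' := den push s in
  exists u : 'I_n, [/\ s' 24 0 = u, u \in x :: p, vis u < vis v,
    forall w u' : 'I_n, w \in p -> s 5 w = u' -> vis w <= vis u ->
     0 < entries (s' 2) u' w & flow_at s' (fun A => y A + (u \in A))].
Proof.
move=> so sx sv vx vp hpar hR hf.
have {}vp : v \in p by move: vp; rewrite inE (negPf vx).
have [u [pu up uv _]] := hpar v vp.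
exists u.
have dv : ((v - x) + (x - v) != 0)%N.
  by apply: contra vx => /eqP h; apply/eqP/val_inj => /=; lia.
have vis_ne : u != v by apply: contraTneq uv => ->; rewrite ltnn.
rewrite /push /= sv sx dv /=.
set s' := update _ _ _ _.
have s'R a b : entries (s' 2) a b =
    if (a, b) == (v, u) then (entries (s 2) v u).+1 else
    if (a, b) == (u, v) then (entries (s 2) u v).-1 else entries (s 2) a b.
  rewrite /entries /s' /update /= ?sv ?pu /= ?so ?eqxx /= ?pair_index_eq.
  rewrite [(v, u) == (u, v)]xpair_eqE [v == u]eq_sym (negPf vis_ne) /= addn1.
  by case: ifP => // _; case: ifP => // _; rewrite subn1.
have Ruv : 0 < entries (s 2) u v by apply: hR.
split=> //.
- move=> w u' wp pw wu; rewrite s'R; case: ifP => // _.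
  have uw' := hR w u' wp pw (leq_trans wu (ltnW uv)).
  case: eqP => // -[_ wv]; by rewrite -wv ltnNge wu in uv.
- move=> A; rewrite (hf A); congr (_ + _).
  have h : cut (entries (s' 2)) A + (u \in A) = cut (entries (s 2)) A + (v \in A).
    apply: (@cut_push _ (entries (s 2)) (entries (s' 2)) u v A vis_ne Ruv).
    - by rewrite s'R [(u, v) == (v, u)]xpair_eqE (negPf vis_ne) eqxx.
    - by rewrite s'R eqxx.
    by move=> a b /negPf h1 /negPf h2; rewrite s'R h1 h2.
  by rewrite addnCA -h addnCA.
Qed.

Lemma augmentP s x y :
  s 0 0 = n -> (forall u : 'I_n, s 3 u = u * n) -> s 23 0 = x -> flow_at s y ->
  let s' := den augment s in
  (s' 29 0 = (s 29 0).+1 /\ flow_at s' (fun A => y A + (x \in A))) \/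
  [/\ s' 29 0 = s 29 0, flow_at s' y &
    exists2 A : {set 'I_n}, x \in A & cut c A + #|A :&: S| = y A].
Proof.
move=> s0 so sx hf.
have [p [hs hcl]] := searchP s0 sx so.
set s1 := den search s in hs.
set scan := PFor 33 0 (pif (Cell 4 (scal 33)) [:: pif (Cell 9 (scal 33)) [::
      pset 28 (Plus (scal 33) (Const 1)) ]]).
set s2 := den scan (den (pset 28 (Const 0)) s1).
have fr1 k : k \notin writes search -> s1 k = s k by apply: den_frame.
have fr2 k : k \notin 28 :: 33 :: writes search -> s2 k = s k.
  rewrite in_cons => /norP[k28]; rewrite in_cons => /norP[k33 kw].
  rewrite /s2 den_frame; last by rewrite /= !inE negb_or k33 k28.
  by rewrite /= update_other // fr1.
have fr21 k : k \notin [:: 28; 33] -> s2 k = s1 k.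
  rewrite !inE => /norP[k28 k33].
  rewrite /s2 den_frame; last by rewrite /= !inE negb_or k33 k28.
  by rewrite /= update_other.
(* Cell 28 holds a reachable sink plus 1, so that 0 means none. *)
have scanP : (exists v : 'I_n, [/\ s2 28 0 = v.+1, v \in x :: p & 0 < s 9 v]) \/
    s2 28 0 = 0 /\ forall v : 'I_n, v \in x :: p -> s 9 v = 0.
  pose Inv k (t : store) := [/\ t 4 = s1 4, t 9 = s 9 &
    (exists v : 'I_n, [/\ t 28 0 = v.+1, v \in x :: p & 0 < s 9 v]) \/
    t 28 0 = 0 /\ forall v : 'I_n, v < k -> v \in x :: p -> s 9 v = 0].
  suff : Inv n s2.
    case=> _ _ [h|[h1 h2]]; [by left|right; split=> // v; exact: h2].
  apply: (for_rule (Inv := Inv)) => //.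
  - by rewrite /= update_other // fr1.
  - split; first by [].
      by rewrite /= update_other // fr1.
    by right; split.
  move=> k t kn tk _ [t4 t9 tI].
  pose v := Ordinal kn.
  have old : ~~ ((v \in x :: p) && (0 < s 9 v)) -> Inv k.+1 t.
    move=> hv; split=> //; case: tI => [h|[h1 h2]]; [by left|right; split=> // w].
    rewrite ltnS leq_eqVlt => /orP[/eqP wk|]; last exact: h2.
    have -> : w = v by apply: val_inj.
    by move=> vp; move: hv; rewrite vp lt0n negbK => /eqP.
  rewrite /= tk t4 t9 -lt0n (sr_vis hs v).
  case: ifP => vp; last by apply: old; rewrite vp.
  case: ifP => /= sv; last by apply: old; rewrite vp lt0n /= sv.
  split=> //; left; exists v; split=> //; last by rewrite lt0n.
  by rewrite /update /= ?tk addn1.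
have E : den augment s = den (pif (scal 28) [::
      pset 24 (Minus (scal 28) (Const 1));
      PAssign 9 (scal 24) (Minus (Cell 9 (scal 24)) (Const 1));
      pset 29 (Plus (scal 29) (Const 1));
      PFor 33 0 push ]) s2 by [].
rewrite E.
case: scanP => [[v [s28 vp sv]]|[s28 hall]]; last first.
  right; rewrite /= s28 /= /flow_at !fr2 //; split=> //.
  (* No residual capacity leaves the visited set and no sink capacity is left in it: the invariant
     becomes the equation of a saturated set. *)
  exists [set v in x :: p]; first by rewrite inE mem_head.
  rewrite hf /cut /weight big1 ?add0n; last first.
    move=> [a b] _ /=; rewrite !inE -!in_cons; case: (boolP (a \in _)) => // ap.
    case: (boolP (b \in x :: p)) => // bp.
    suff -> : entries (s 2) a b = 0 by rewrite muln0.
    by apply/eqP; rewrite -leqn0 leqNgt; apply: contra bp => h; apply: hcl h.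
  by rewrite big1 ?addn0 // => w; rewrite inE => /hall.
left; rewrite den_pif [eval _ _]/= s28 !den_pseq.
set s3 := den (pset 29 _) _.
have -> : den (pseq [::]) (den (PFor 33 0 push) s3) = den (PFor 33 0 push) s3 by [].
have {}s3E : s3 = update (update (update s2 24 0 v) 9 v (s 9 v - 1)) 29 0 (s 29 0 + 1).
  by rewrite /s3 /= s28 subn1 /= /update /= !fr2.
have -> : (v.+1 != 0) = true by []; cbv iota; clearbody s3.
have E3 : s3 2 = s 2 /\ s3 3 = s 3.
  by split; rewrite s3E !update_other // fr2.
have [E32 E33] := E3.
have E35 : s3 5 = s1 5 by rewrite s3E !update_other // fr21.
have E39 (w : 'I_n) : s3 9 w = s 9 w - (w == v).
  rewrite s3E /update /= fr2 //= -val_eqE /=.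
  by case: eqP => [->|]; rewrite ?subn0 ?subn1.
(* Each push lowers the visiting time of the start. After n pushes a start other than [x] would have
   time 0, but visited vertices have positive times. *)
pose Inv k (t : store) := [/\ t 3 = s 3 /\ t 5 = s1 5, t 23 0 = x, t 29 0 = (s 29 0).+1 &
  exists w : 'I_n, [/\ t 24 0 = w, w \in x :: p, (w == x) || (s1 4 w + k <= n),
    forall w' u : 'I_n, w' \in p -> s1 5 w' = u -> s1 4 w' <= s1 4 w ->
       0 < entries (t 2) u w' & flow_at t (fun A => y A + (w \in A))]].
have cntn : s1 22 0 <= n.
  rewrite (sr_cnt hs); have := uniq_leq_size (sr_uniq hs) (fun v _ => mem_enum 'I_n v).
  by rewrite -cardE card_ord.
suff : Inv n (den (PFor 33 0 push) s3).
  case=> _ _ h29 [w [h1 h2 h3 _ h4]]; split=> //.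
  move: h2; rewrite -(sr_vis hs) => w0.
  by case/orP: h3 h4 => [/eqP->|] //; move: w0; clear; lia.
apply: (for_rule (Inv := Inv)) => //.
- by rewrite s3E !update_other // fr2.
- split=> //.
  + by rewrite s3E !update_other // fr2.
  + by rewrite s3E /update /= addn1.
  exists v; split=> //.
  + by rewrite s3E /update /=.
  + by rewrite addn0 (leq_trans (sr_vis_le hs v) cntn) orbT.
  + move=> w u wp pw _; rewrite E32.
    by have [u' [pu' _ _]] := sr_par hs wp; have -> : u = u' by apply: val_inj; rewrite /= -pw.
  (* At first the unit both starts and is absorbed at the sink [v]. *)
  + move=> A; rewrite E32 hf -!addnA; congr (_ + (_ + _)).
    have -> : \sum_(w in A) s 9 w = \sum_(w in A) (s3 9 w + (w == v)).
      apply: eq_bigr => w _; rewrite E39.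
      by case: (w =P v) => [->|_]; rewrite ?addn0 ?subn0 // subnK.
    rewrite big_split /= addnC; congr (_ + _).
    rewrite big_mkcond (bigD1 v) //= eqxx big1 ?addn0.
      by case: (v \in A).
    by move=> w /negPf->; case: ifP.
move=> k t kn _ _ [[t3 t5] t23 t29 [w [tw wp hw hR hflow]]].
case: (eqVneq w x) => [wx|wx].
  have -> : den push t = t by rewrite /push /= tw t23 wx subnn.
  split=> //; exists w; split=> //; by rewrite wx eqxx.
have so' (u : 'I_n) : t 3 u = u * n by rewrite t3.
have hpar w' : w' \in p -> exists u : 'I_n,
     [/\ t 5 w' = u, u \in x :: p, s1 4 u < s1 4 w' & s1 4 w' <= s1 22 0].
  move=> wp'; have [u [h1 h2 h3 _]] := sr_par hs wp'.
  by exists u; rewrite t5; split=> //; apply: sr_vis_le hs _.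
rewrite -t5 in hR.
have [u [h1 h2 h3 h4 h5]] := pushP so' t23 tw wx wp hpar hR hflow.
have fr k' : k' \notin [:: 16; 2; 24] -> den push t k' = t k'.
  rewrite !inE !negb_or => /and3P[a b d]; apply: den_frame.
  by rewrite /= !inE !negb_or a b d.
split; [by rewrite !fr|by rewrite fr|by rewrite fr|].
exists u; split=> //; last by rewrite -t5.
apply/orP; right; move: hw; rewrite (negPf wx) /=; move: h3; clear; lia.
Qed.

End Augment.

(** * Greedy selection in turns *)

Definition fill_vec (k : nat) (a : expr) : prg := PFor 36 0 (PAssign k (scal 36) a).

Definition fill_mat (k : nat) (a : expr) : prg :=
  PFor 36 0 (PFor 37 0 (PAssign k (Plus (Cell 3 (scal 36)) (scal 37)) a)).

Section Fill.
Variable n : nat.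

Lemma fill_vecP (g : nat -> nat) k a (s : store) :
  k \notin [:: 0; 36] -> s 0 0 = n ->
  (forall (t : store) v, v < n -> (forall l, l \notin [:: k; 36] -> t l = s l) ->
     t 36 0 = v -> eval t a = g v) ->
  forall v : 'I_n, den (fill_vec k a) s k v = g v.
Proof.
rewrite !inE negb_or => /andP[k0 k36] s0 ha.
pose Inv l (t : store) := (forall i, i \notin [:: k; 36] -> t i = s i) /\
  forall v, v < l -> t k v = g v.
suff [_ h] : Inv n (den (fill_vec k a) s) by move=> v; apply: h.
apply: (for_rule (Inv := Inv)) => //=.
- by rewrite inE k0 eq_sym k36.
- move=> l t v [h1 h2]; split=> [i hi|w wl].
    by rewrite update_other ?h1 //; move: hi; rewrite !inE negb_or => /andP[].
  by rewrite update_other // h2.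
move=> l t ln tl _ [h1 h2]; split=> [i hi|w wl].
  by rewrite update_other ?h1 //; move: hi; rewrite !inE negb_or => /andP[].
rewrite /update eqxx tl /=; case: eqP => [->|wl']; first exact: ha.
by apply: h2; move: wl wl'; clear; lia.
Qed.

Lemma fill_matP (g : 'I_n -> 'I_n -> nat) k a (s : store) :
  k \notin [:: 0; 3; 36; 37] -> s 0 0 = n -> (forall u : 'I_n, s 3 u = u * n) ->
  (forall (t : store) (u v : 'I_n), (forall l, l \notin [:: k; 36; 37] -> t l = s l) ->
     t 36 0 = u -> t 37 0 = v -> eval t a = g u v) ->
  forall u v : 'I_n, entries (den (fill_mat k a) s k) u v = g u v.
Proof.
rewrite !inE !negb_or => /and4P[k0 k3 k36 k37] s0 so ha.
pose Fr (t : store) := forall i, i \notin [:: k; 36; 37] -> t i = s i.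
pose outer l (t : store) := Fr t /\
  forall u v : 'I_n, u < l -> entries (t k) u v = g u v.
have FrU t i j v : Fr t -> i \in [:: k; 36; 37] -> Fr (update t i j v).
  by move=> ht hi l hl; rewrite update_other ?ht //; apply: contraNneq hl => ->.
suff [_ h] : outer n (den (fill_mat k a) s) by move=> u v; apply: h.
apply: (for_rule (Inv := outer)) => //=.
- by rewrite !inE k0 ![_ == k]eq_sym k36 k37.
- move=> l t v [h1 h2]; split; first by apply: FrU; rewrite // !inE eqxx orbT.
  by rewrite update_other.
move=> p t pn tp t0 [h1 h2].
pose inner l (t : store) := [/\ Fr t, t 36 0 = p &
  forall u v : 'I_n, (u < p) || (u == p :> nat) && (v < l) -> entries (t k) u v = g u v].
suff [h3 _ h4] : inner n (den (PFor 37 0 (PAssign k (Plus (Cell 3 (scal 36)) (scal 37)) a)) t).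
  split=> // u v up; apply: h4; rewrite ltn_ord andbT.
  by move: up; clear; lia.
apply: (for_rule (Inv := inner)) => //=.
- by rewrite !inE k0 ![_ == k]eq_sym k37.
- by split=> // u v; rewrite andbF orbF; apply: h2.
- move=> l t1 v [h3 h4 h5]; split=> //; first by apply: FrU; rewrite // !inE eqxx !orbT.
  by rewrite update_other.
move=> l t1 ln t1l _ [h3 h4 h5]; split.
- by apply: FrU; rewrite // !inE eqxx.
- by rewrite update_other 1?eq_sym.
move=> u v; rewrite /entries /update eqxx h4 t1l h3 ?inE ?negb_or ?[3 == k]eq_sym ?k3 //=.
rewrite (so (Ordinal pn)) (pair_index_eq u (Ordinal pn) v (Ordinal ln)) xpair_eqE -!val_eqE /=.
case: ifP => [/andP[/eqP up /eqP vl] _|hne uv].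
  by apply: ha => //; rewrite ?h4 ?t1l.
by apply: h5; move: hne uv; clear; lia.
Qed.

End Fill.

(* Sends three units of flow from the vertex in cell 23, or nothing at all. *)
Definition send3 : prg :=
  pseq [:: fill_mat 10 (entry 2 (scal 36) (scal 37)); fill_vec 11 (Cell 9 (scal 36));
    pset 29 (Const 0); augment; augment; augment;
    pifnot (Minus (scal 29) (Const 2)) [::
      fill_mat 2 (entry 10 (scal 36) (scal 37)); fill_vec 9 (Cell 11 (scal 36)) ]].

Section Send.
Variable n : nat.
Variables (c : 'I_n -> 'I_n -> nat) (S : {set 'I_n}).
Implicit Types (y : {set 'I_n} -> nat) (s : store) (x : 'I_n).

Lemma eq_flow_at s s' y y' : (forall u v : 'I_n, entries (s 2) u v = entries (s' 2) u v) ->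
  (forall v : 'I_n, s 9 v = s' 9 v) -> y =1 y' -> flow_at c S s y -> flow_at c S s' y'.
Proof.
move=> h2 h9 hy hf A; rewrite (hf A) -hy; congr (_ + _ + _).
  by apply: eq_weight => u v _ _.
by apply: eq_bigr => v _; rewrite h9.
Qed.

(** If only i <= 2 units get through, a saturated set contains [x] and has [f A = y A + i]: this is
    the slack 2 of a rejection. Restoring the backup makes the rejection leave the flow as it
    was. *)
Lemma send3P s x y :
  s 0 0 = n -> (forall u : 'I_n, s 3 u = u * n) -> s 23 0 = x -> flow_at c S s y ->
  let s' := den send3 s in
  (2 < s' 29 0 /\ flow_at c S s' (fun A => y A + 3 * (x \in A))) \/
  [/\ s' 29 0 <= 2, flow_at c S s' y &
    exists2 A : {set 'I_n}, x \in A & cut c A + #|A :&: S| <= y A + 2].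
Proof.
move=> s0 so sx hf.
rewrite /send3 7!den_pseq den_pseq0.
set sA := den (fill_mat 10 _) s.
have frA k : k \notin [:: 36; 37; 10] -> sA k = s k by move=> h; rewrite /sA den_frame.
have sAm (u v : 'I_n) : entries (sA 10) u v = entries (s 2) u v.
  apply: (@fill_matP n (entries (s 2))) => // t a b fr t36 t37.
  by rewrite /= t36 t37 !fr // so.
clearbody sA; set sB := den (fill_vec 11 _) sA.
have frB k : k \notin [:: 36; 11] -> sB k = sA k by move=> h; rewrite /sB den_frame.
have sBv (v : 'I_n) : sB 11 v = s 9 v.
  apply: (@fill_vecP n (s 9)) => [//||t a _ fr t36]; first by rewrite frA.
  by rewrite /= t36 fr // frA.
clearbody sB; set s1 := den (pset 29 (Const 0)) sB.
have z1 : s1 29 0 = 0 by [].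
have fr1 k : k \notin [:: 10; 11; 29; 36; 37] -> s1 k = s k.
  rewrite !inE !negb_or => /and5P[h1 h2 h3 h4 h5].
  rewrite /s1 /= update_other // frB ?frA // !inE !negb_or ?h4 ?h5 ?h1 ?h2 //.
have s1m (u v : 'I_n) : entries (s1 10) u v = entries (s 2) u v.
  by rewrite /s1 /= update_other // frB.
have s1v (v : 'I_n) : s1 11 v = s 9 v by rewrite /s1 /= update_other.
clearbody s1.
pose ctx (t : store) := [/\ t 0 0 = n, forall u : 'I_n, t 3 u = u * n, t 23 0 = x,
   forall u v : 'I_n, entries (t 10) u v = entries (s 2) u v  & forall v : 'I_n, t 11 v = s 9 v].
have c1 : ctx s1 by split=> *; rewrite ?s1m ?s1v ?fr1 ?so.
have ctxA t : ctx t -> ctx (den augment t).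
  by case=> h1 h2 h3 h4 h5; split=> *; rewrite (den_frame (p := augment)) // ?h2 ?h4 ?h5.
pose fail := exists2 A : {set 'I_n}, x \in A & cut c A + #|A :&: S| <= y A + 2.
pose st i t := [/\ ctx t, t 29 0 <= i, (t 29 0 < i) -> fail &
   flow_at c S t (fun A => y A + t 29 0 * (x \in A))].
have st1 : st 0 s1.
  split; rewrite ?z1 //; apply: eq_flow_at hf => [u v|v|A]; rewrite ?fr1 //.
  by rewrite mul0n addn0.
have stA i t : i < 3 -> st i t -> st i.+1 (den augment t).
  move=> i3 [ct ti tf tfl]; case: (ct) => t0 to tx _ _.
  have := augmentP t0 to tx tfl; set t' := den augment t => -[[h1 h2]|[h1 h2 [A xA hA]]].
    split; rewrite ?h1; [exact: ctxA|by []|by rewrite ltnS|].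
    apply: eq_flow_at h2 => // B; by rewrite mulSn; lia.
  split; rewrite ?h1; [exact: ctxA|exact: leqW| |exact: h2].
  move=> _; case: (ltnP (t 29 0) i) => [/tf //|it].
  by exists A => //; rewrite hA xA muln1 leq_add2l; lia.
set s2 := den augment (den augment (den augment s1)).
have [c2 h3 hfail hfl] : st 3 s2 by do 3!apply: (stA) => //.
clearbody s2.
case: (ltnP 2 (s2 29 0)) => h29.
  have e3 : s2 29 0 = 3 by apply/eqP; rewrite eqn_leq h3 h29.
  left; rewrite den_pifnot_true; last by rewrite /= e3.
  by rewrite e3 in hfl *.
right.
have e3 : s2 29 0 - 2 = 0 by apply/eqP; rewrite subn_eq0.
case: c2 => g0 go gx gm gv; pose sC := den (fill_mat 2 (entry 10 (scal 36) (scal 37))) s2.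
rewrite den_pifnot_false //.
have -> : den (pseq [:: fill_mat 2 (entry 10 (scal 36) (scal 37));
    fill_vec 9 (Cell 11 (scal 36))]) s2 = den (fill_vec 9 (Cell 11 (scal 36))) sC.
  by rewrite 2!den_pseq den_pseq0.
have frC k : k \notin [:: 36; 37; 2] -> sC k = s2 k by move=> h; rewrite /sC den_frame.
have sCm (u v : 'I_n) : entries (sC 2) u v = entries (s 2) u v.
  apply: (@fill_matP n (entries (s 2))) => // t a b fr t36 t37.
  by rewrite /= t36 t37 !fr // go; exact: gm.
clearbody sC.
split; [|  |exact: hfail].
- have -> : den (fill_vec 9 (Cell 11 (scal 36))) sC 29 = sC 29 by apply: den_frame.
  by rewrite frC.
apply: eq_flow_at hf => // [u v|v].
  by rewrite den_frame // sCm.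
apply/esym; apply: (@fill_vecP n (s 9)) => [//||t a an fr t36]; first by rewrite frC.
by rewrite /= t36 fr // frC // (gv (Ordinal an)).
Qed.

End Send.

(** A successful attempt sets cell 26, which ends the turn of the current set. *)
Definition round_robin (attempt : prg) : prg :=
  PFor 40 0 (PFor 41 1 (pseq [:: pset 26 (Const 0);
    PFor 42 0 (pifnot (scal 26) [:: attempt])])).

Section RoundRobin.
Variables (n r : nat) (attempt : prg).
Variable St : store -> ('I_r -> {set 'I_n}) -> Prop.
Variable blocked : 'I_r -> 'I_n -> ('I_r -> {set 'I_n}) -> Prop.
Variables (K : 'I_r -> nat) (a b : nat).

Definition enlarge (Y : 'I_r -> {set 'I_n}) j x : 'I_r -> {set 'I_n} :=
  fun i => if i == j then x |: Y i else Y i.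

Hypothesis attempt_wf : wf attempt.
Hypothesis attempt_fr : all (fun k => k \notin writes attempt) [:: 40; 41; 42].
Hypothesis St_update : forall s Y k i v, k \in [:: 26; 40; 41; 42] ->
  St s Y -> St (update s k i v) Y.
Hypothesis attemptP : forall s Y (j : 'I_r) (x : 'I_n),
  St s Y -> s 41 0 = j -> s 42 0 = x -> s 26 0 = 0 ->
  let s' := den attempt s in
  [/\ s' 26 0 != 0, x \notin Y j & St s' (enlarge Y j x)] \/
  [/\ s' 26 0 = 0, St s' Y & blocked j x Y].
Hypothesis K_bound : forall s Y j, St s Y -> (forall x, blocked j x Y) ->
  K j <= a + b * \sum_i #|Y i|.
Hypothesis K_le : forall j, K j <= n.
Hypothesis b_gt0 : 0 < b.

(** If set j first fails after l full rounds, it has at least l elements, while the total is at most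
    r * l + j, since a turn adds at most one. A set that never fails ends with n elements. *)
Lemma round_robinP s : s 0 0 = n -> s 0 1 = r -> St s (fun _ => set0) ->
  exists2 Y, St (den (round_robin attempt) s) Y &
    forall j, K j <= a + b * (r * #|Y j|.+1).
Proof.
move=> s0 s1 Ss.
have [f40 f41 f42] : [/\ 40 \notin writes attempt, 41 \notin writes attempt & 42 \notin writes attempt].
  by case/and4P: attempt_fr.
pose base (t : store) := t 0 = s 0.
(* The second alternative, reached at the first failure, persists because the sets only grow. *)
pose st l j t := base t /\ exists Y, [/\ St t Y, \sum_i #|Y i| <= r * l + j &
  forall i : 'I_r, (l + (i < j) <= #|Y i|) \/ K i <= a + b * (r * #|Y i|.+1)].
have f0 := wf_writes0 attempt_wf.
suff : st n 0 (den (round_robin attempt) s).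
  case=> _ [Y [h1 _ h2]]; exists Y => // j.
  case: (h2 j) => //; rewrite addn0 => nY.
  apply: leq_trans (K_le j) _; apply: leq_trans nY _.
  have r0 : 0 < r := leq_ltn_trans (leq0n j) (ltn_ord j).
  apply: leq_trans (leq_addl _ _); apply: leq_trans (leqnSn _) _.
  by rewrite mulnA leq_pmull // muln_gt0 b_gt0.
have stU l j t k i v : k \in [:: 26; 40; 41; 42] -> st l j t -> st l j (update t k i v).
  move=> kk [h1 [Y [h2 h3 h4]]]; split.
    by rewrite /base update_other //; apply: contraTneq kk => <-.
  by exists Y; split=> //; apply: St_update.
apply: (for_rule (Inv := fun l => st l 0)) => //.
- by rewrite /= !cats0 !inE !negb_or /= f40 f41 f42 attempt_wf.
- split=> //; exists (fun _ => set0); split=> //.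
    by rewrite big1 // => i _; rewrite cards0.
  by move=> i; left.
- by move=> *; apply: stU.
move=> l t ln _ t0 stt.
suff : st l r (den (PFor 41 1 (pseq [:: pset 26 (Const 0);
    PFor 42 0 (pifnot (scal 26) [:: attempt])])) t).
  case=> h1 [Y [h2 h3 h4]]; split=> //; exists Y; split=> //.
    by rewrite addn0 mulnS addnC.
  by move=> i; have := h4 i; rewrite ltn_ord addn0 addn1.
apply: (for_rule (Inv := st l)) => //.
- by rewrite /= !cats0 !inE ?negb_or /= f41 f42 attempt_wf.
- by rewrite stt.1.
- by move=> *; apply: stU.
move=> j u jr uj u0 [h1 [Y [h2 h3 h4]]].
rewrite den_pseq; set u1 := den (pset 26 _) u.
have -> : den (pseq [:: PFor 42 0 (pifnot (scal 26) [:: attempt])]) u1 =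
  den (PFor 42 0 (pifnot (scal 26) [:: attempt])) u1 by [].
pose jj := Ordinal jr.
pose Inv k (t : store) := [/\ base t, t 41 0 = j &
  (t 26 0 != 0 /\ exists x, x \notin Y jj /\ St t (enlarge Y jj x)) \/
  [/\ t 26 0 = 0, St t Y & forall x : 'I_n, x < k -> blocked jj x Y]].
suff : Inv n (den (PFor 42 0 (pifnot (scal 26) [:: attempt])) u1).
  case=> g1 _ [[_ [x [xY g2]]]|[_ g2 g3]]; split=> //.
    exists (enlarge Y jj x); split=> //.
      rewrite (bigD1 jj) //= /enlarge eqxx cardsU1 xY.
      rewrite (eq_bigr (fun i => #|Y i|)) => [|i /negPf->] //.
      by move: h3; rewrite (bigD1 jj) //=; clear; lia.
    move=> i; rewrite /enlarge; case: (altP (i =P jj)) => [->|ij].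
      rewrite cardsU1 xY /= ltnSn; case: (h4 jj) => /= hh; [left|right].
        by move: hh; rewrite ltnn; clear; lia.
      apply: leq_trans hh _; rewrite leq_add2l leq_mul2l leq_mul2l; apply/orP; right.
      by apply/orP; right; clear; lia.
    have -> : (i < j.+1) = (i < j); last exact: h4.
    by move: ij; rewrite -val_eqE /=; clear; lia.
  exists Y; split=> //; first by move: h3; clear; lia.
  move=> i; case: (altP (i =P jj)) => [->|ij]; last first.
    have -> : (i < j.+1) = (i < j); last exact: h4.
    by move: ij; rewrite -val_eqE /=; clear; lia.
  right; case: (h4 jj) => //=; rewrite ltnn addn0 => lY.
  apply: leq_trans (K_bound g2 (fun x => g3 x (ltn_ord x))) _.
  rewrite leq_add2l leq_mul2l; apply/orP; right; apply: leq_trans h3 _.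
  by rewrite mulnS addnC leq_add ?(ltnW jr) // leq_mul2l lY orbT.
have b42 t' v : base t' -> base (update t' 42 0 v) by [].
apply: (for_rule (Inv := Inv)) => //.
- by rewrite /= !cats0 f42 attempt_wf.
- by rewrite /u1 /= update_other // h1.
- split=> //; right; split=> //; exact: St_update.
- move=> k t1 v [g1 g2 g3]; split=> //.
  case: g3 => [[g4 [x [g5 g6]]]|[g4 g5 g6]]; [left|right].
    by split=> //; exists x; split=> //; apply: St_update.
  by split=> //; apply: St_update.
move=> k t1 kn t1k _ [g1 g2 g3]; rewrite den_pifnot [eval _ _]/=.
have gg : base (den (pseq [:: attempt]) t1) /\ den (pseq [:: attempt]) t1 41 0 = j.
  by rewrite /base /= !den_frame.
case: g3 => [[g4 g5]|[g4 g5 g6]].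
  by rewrite g4; split=> //; left.
rewrite g4 eqxx; split; [exact: gg.1|exact: gg.2|].
case: (attemptP (x := Ordinal kn) (j := jj) g5 g2 t1k g4) => [[q1 q2 q3]|[q1 q2 q3]]; [left|right].
  by split=> //; exists (Ordinal kn).
split=> // x; rewrite ltnS leq_eqVlt => /orP[/eqP xk|]; last exact: g6.
by have -> : x = Ordinal kn by apply: val_inj.
Qed.

End RoundRobin.

(** * Input tables and the ordering of the vertices *)

Definition size_cell : expr := Cell 0 (Const 0).

Definition row_step : prg :=
  pseq [:: PAssign 3 (scal 34) (scal 20); pset 20 (Plus (scal 20) size_cell)].

(** Without multiplication, the products u * n are tabulated by repeated addition. Entry n, that is
    n * n, locates the terminal vectors behind the adjacency matrix; the second loop reaches rows up
    to r, which may exceed n, and otherwise rewrites equal values. *)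
Definition row_table : prg :=
  pseq [:: pset 20 (Const 0); PFor 34 0 row_step; PAssign 3 size_cell (scal 20);
    pset 20 (Const 0); PFor 34 1 row_step].

(** Finds the least m with b <= m * a by repeated addition, stopping at n: this keeps the loop short
    when q is tiny, and in a connected graph m = n is always large enough. *)
Definition spacing : prg :=
  pseq [:: pset 20 (Const 0); pset 21 (Const 0);
    PFor 34 0 (pif (Minus (Cell 0 (Const 3)) (scal 20)) [::
      pset 20 (Plus (scal 20) (Cell 0 (Const 2)));
      pset 21 (Plus (scal 21) (Const 1)) ])].

Definition adjacency (a b : expr) : expr := Cell 0 (Plus (Const 4) (Plus (Cell 3 a) b)).

Definition terminal (j x : expr) : expr :=
  Cell 0 (Plus (Plus (Const 4) (Cell 3 size_cell)) (Plus (Cell 3 j) x)).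

Definition tour : prg :=
  pseq [:: fill_mat 2 (adjacency (scal 36) (scal 37)); pset 23 (Const 0); search].

Definition unite : prg :=
  PFor 34 1 (PFor 35 0 (pif (terminal (scal 34) (scal 35)) [::
    PAssign 14 (scal 35) (Const 1) ])).

Definition walk : prg :=
  pseq [:: pset 24 (Const 0); pset 25 (Const 0);
    PFor 34 0 (pseq [:: PAssign 7 (scal 24) (scal 25);
      pset 25 (Plus (scal 25) (Cell 14 (scal 24)));
      pset 24 (Cell 6 (scal 24)) ])].

Lemma index_eq n (u u' : nat) (v v' : 'I_n) :
  (u * n + v == u' * n + v') = (u == u') && (v == v').
Proof.
apply/eqP/andP => [h|[/eqP-> /eqP->]] //.
have n0 : 0 < n := leq_ltn_trans (leq0n v) (ltn_ord v).
split; last first.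
  by apply/eqP/val_inj; move: (congr1 (modn^~ n) h); rewrite !modnMDl !modn_small.
apply/eqP.
by move: (congr1 (divn^~ n) h); rewrite !divnMDl // !divn_small // !addn0; exact.
Qed.

Section Phase1.
Variables (n r : nat) (e : rel 'I_n) (T : 'I_r -> {set 'I_n}) (a b : nat).
Hypotheses (e_sym : symmetric e) (e_conn : forall x y : 'I_n, connect e x y).
Hypothesis n_gt0 : 0 < n.
Variable inp : nat -> nat.
Hypotheses (inp0 : inp 0 = n) (inp1 : inp 1 = r) (inp2 : inp 2 = a) (inp3 : inp 3 = b).
Hypothesis inp_e : forall u v : 'I_n, inp (4 + (u * n + v)) = e u v.
Hypothesis inp_T : forall (j : 'I_r) (x : 'I_n),
  inp (4 + n * n + (j * n + x)) = (x \in T j).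

Let TT := \bigcup_j T j.

Lemma row_tableP s : s 0 = inp -> forall u, u <= n \/ u < r ->
  den row_table s 3 u = u * n.
Proof.
move=> s0.
set s1 := den (pset 20 (Const 0)) s.
set s2 := den (PFor 34 0 row_step) s1.
have s2I : [/\ s2 0 = inp, s2 20 0 = n * n & forall u, u < n -> s2 3 u = u * n].
  pose Inv k (t : store) := [/\ t 0 = inp, t 20 0 = k * n & forall u, u < k -> t 3 u = u * n].
  apply: (for_rule (Inv := Inv)) => //.
  - by rewrite /s1 /= update_other // s0.
  move=> k t kn tk _ [h1 h2 h3]; rewrite /row_step; split.
  - by rewrite den_frame.
  - by rewrite /= /update /= h2 h1 inp0 mulSn addnC.
  move=> u uk; rewrite /= /update /= tk h2; case: eqP => [->|] // uk'.
  by apply: h3; move: uk uk'; clear; lia.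
set s3 := den (pset 20 (Const 0)) (den (PAssign 3 size_cell (scal 20)) s2).
have -> : den row_table s = den (PFor 34 1 row_step) s3 by [].
case: s2I => h1 h2 h3.
pose Inv k (t : store) := [/\ t 0 = inp, t 20 0 = k * n &
  forall u, u <= n \/ u < k -> t 3 u = u * n].
suff [_ _ h] : Inv r (den (PFor 34 1 row_step) s3) by [].
apply: (for_rule (Inv := Inv)) => //.
- by rewrite /s3 /= !update_other // h1.
- split=> //.
  move=> u; rewrite /s3 /= /update /= h1 inp0 h2 => hu.
  case: eqP => [->|un] //; apply: h3; move: hu un; clear; lia.
move=> k t kn tk _ [g1 g2 g3]; rewrite /row_step; split.
- by rewrite den_frame.
- by rewrite /= /update /= g2 g1 inp0 mulSn addnC.
move=> u uk; rewrite /= /update /= tk g2; case: eqP => [->|] // uk'.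
by apply: g3; move: uk uk'; clear; lia.
Qed.

Lemma spacingP s : s 0 = inp -> let m := den spacing s 21 0 in
  [/\ m <= n, b <= m * a \/ m = n & m = 0 \/ m.-1 * a < b].
Proof.
move=> s0.
pose Inv k (t : store) := [/\ t 0 = inp, t 20 0 = t 21 0 * a, t 21 0 <= k,
  b <= t 21 0 * a \/ t 21 0 = k & t 21 0 = 0 \/ (t 21 0).-1 * a < b].
set s1 := den (pset 21 (Const 0)) (den (pset 20 (Const 0)) s).
suff [_ _ ? ? ?] : Inv n (den (PFor 34 0 (pif (Minus (Cell 0 (Const 3)) (scal 20)) [::
      pset 20 (Plus (scal 20) (Cell 0 (Const 2)));
      pset 21 (Plus (scal 21) (Const 1)) ])) s1) by [].
apply: (for_rule (Inv := Inv)) => //.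
- by rewrite /s1 /= !update_other // s0.
- by split=> //; [right|left].
move=> k t kn tk _ [h1 h2 h3 h4 h5].
rewrite den_pif /= h1 inp3 h2; case: ifP => hb; last first.
  split=> //; [exact: leqW|left; move: hb; clear; lia].
split; [by rewrite !update_other| | | |].
- by rewrite /update /= ?h1 ?inp2 ?h2 mulnDl mul1n.
- by rewrite /update /=; move: h3; clear; lia.
- rewrite /update /=; right; case: h4 => [h4|->]; last by rewrite addn1.
  by move: h4 hb; clear; lia.
by rewrite /update /= addn1 /=; right; move: hb; clear; lia.
Qed.

Lemma tourP s : s 0 = inp -> (forall u : 'I_n, s 3 u = u * n) ->
  let s' := den tour s in
  (forall u v : 'I_n, entries (s' 2) u v = e u v) /\
  exists x p, [/\ nat_of_ord x = 0, uniq (x :: p), forall v, v \in x :: p,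
    path (fun u v : 'I_n => s' 6 u == v) x p &
    forall A : {set 'I_n}, exits A x p <= #|edges_between e A (~: A)|].
Proof.
move=> s0 so.
set s1 := den (fill_mat 2 (adjacency (scal 36) (scal 37))) s.
set s2 := den (pset 23 (Const 0)) s1.
have -> : den tour s = den search s2 by [].
have s2e (u v : 'I_n) : entries (s2 2) u v = e u v.
  rewrite /s2 /= update_other //.
  apply: (@fill_matP n (fun u v => e u v : nat)) => //; first by rewrite s0.
  by move=> t u' v' fr t36 t37; rewrite /= t36 t37 !fr // so s0 -inp_e.
have s2s : sym_support (s2 2) =2 e.
  by move=> u v; rewrite /sym_support !s2e [e v u]e_sym; case: (e u v).
split.
  by move=> u v; rewrite (den_frame (p := search)).
pose x := Ordinal n_gt0.
have so2 (u : 'I_n) : s2 3 u = u * n by rewrite /s2 /= update_other // /s1 den_frame.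
have s20 : s2 0 0 = n by rewrite /s2 /= update_other // /s1 den_frame // s0.
have [//|p [hs hc]] := @searchP n s2 x s20 _ so2.
have all v : v \in x :: p.
  have /connectP[q] := e_conn x v.
  have: x \in x :: p by exact: mem_head.
  elim: q {1 3 4}x => [|w q IHq] y yp /=; first by move=> _ ->.
  case/andP=> eyw pq lq; apply: (IHq w) => //.
  by apply: hc yp _; rewrite s2e eyw.
exists x, p; split=> //; [exact: sr_uniq hs|exact: sr_nxt hs|].
move=> A; apply: leq_trans (sr_exits hs A) _.
apply: subset_leq_card; apply/subsetP => -[u v]; rewrite !inE /=.
by case/and3P=> /andP[-> _] /andP[-> _]; rewrite s2s.
Qed.

Lemma uniteP s : s 0 = inp -> (forall u, u <= n \/ u < r -> s 3 u = u * n) ->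
  (forall v : 'I_n, s 14 v = 0) ->
  forall v : 'I_n, den unite s 14 v = (v \in TT).
Proof.
move=> s0 so z14.
pose base (t : store) := t 0 = inp /\ forall u, u <= n \/ u < r -> t 3 u = u * n.
pose Inv k (t : store) := base t /\
  forall v : 'I_n, t 14 v = [exists j : 'I_r, (j < k) && (v \in T j)].
suff [_ h] : Inv r (den unite s).
  move=> v; rewrite h; congr nat_of_bool; apply/existsP/bigcupP.
    by case=> j /andP[_ vj]; exists j.
  by case=> j _ vj; exists j; rewrite ltn_ord.
apply: (for_rule (Inv := Inv)) => //.
- by rewrite s0.
- split=> // v; rewrite z14; case: existsP => // -[j]; by rewrite ltn0.
move=> k t kr tk _ [[t0 to] h].
pose jj := Ordinal kr.
pose Inv2 l (t : store) := [/\ base t, t 34 0 = k &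
  forall v : 'I_n, t 14 v = [exists j : 'I_r, (j < k) && (v \in T j)] || ((v < l) && (v \in T jj))].
suff [h1 _ h2] : Inv2 n (den (PFor 35 0 (pif (terminal (scal 34) (scal 35)) [::
    PAssign 14 (scal 35) (Const 1) ])) t).
  split=> // v; rewrite h2; congr nat_of_bool; apply/orP/existsP.
    case=> [/existsP[j /andP[jk vj]]|/andP[_ vj]].
      by exists j; rewrite vj (leq_trans jk).
    by exists jj; rewrite /= ltnSn.
  case=> j /andP[]; rewrite ltnS leq_eqVlt => /orP[/eqP jk|jk] vj.
    by right; rewrite ltn_ord; have <- : j = jj by apply: val_inj.
  by left; apply/existsP; exists j; rewrite jk.
apply: (for_rule (Inv := Inv2)) => //.
- by rewrite t0.
- by split=> // v; rewrite h /= orbF.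
move=> l t1 ln tl _ [[t10 t1o] t1k h1].
have -> : den (pif (terminal (scal 34) (scal 35)) [:: PAssign 14 (scal 35) (Const 1)]) t1 =
    if Ordinal ln \in T jj then update t1 14 l 1 else t1.
  rewrite den_pif /= t1k tl t10 inp0 !t1o; [|by right|by left].
  by rewrite (inp_T jj (Ordinal ln)) eqb0 negbK.
split.
- by case: ifP.
- by case: ifP.
move=> v; case: ifP => vT.
  rewrite /update /=; case: eqP => [vl|vl].
    have -> : v = Ordinal ln by apply: val_inj.
    by rewrite vT /= ltnSn orbT.
  rewrite h1; have -> // : (v < l.+1) = (v < l); by move: vl; clear; lia.
rewrite h1; case: (v =P l :> nat) => [vl|vl].
  have -> : v = Ordinal ln by apply: val_inj.
  by rewrite vT !andbF.
have -> // : (v < l.+1) = (v < l); by move: vl; clear; lia.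
Qed.

Lemma walkP s x p : s 0 = inp -> nat_of_ord x = 0 -> uniq (x :: p) ->
  (forall v : 'I_n, v \in x :: p) -> path (fun u v : 'I_n => s 6 u == v) x p ->
  (forall v : 'I_n, s 14 v = (v \in TT)) ->
  let s' := den walk s in
  (forall v : 'I_n, s' 7 v = rank TT (x :: p) v) /\
  s' 25 0 = count (mem TT) (x :: p).
Proof.
move=> s0 x0 up all pp hT; set L := x :: p in up all *.
have sL : size L = n.
  apply/eqP; rewrite -[X in _ == X]card_ord -(card_uniqP up); apply/eqP/eq_card => v.
  by rewrite all.
pose body := pseq [:: PAssign 7 (scal 24) (scal 25);
      pset 25 (Plus (scal 25) (Cell 14 (scal 24)));
      pset 24 (Cell 6 (scal 24)) ].
set s1 := den (pset 25 (Const 0)) (den (pset 24 (Const 0)) s).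
have -> : den walk s = den (PFor 34 0 body) s1 by [].
(* The successor of the last vertex is unspecified, so cell 24 is known only for [k < n]. *)
pose Inv k (t : store) := [/\ t 6 = s 6 /\ t 14 = s 14,
  forall i, i < k -> t 7 (nth x L i) = count (mem TT) (take i L),
  t 25 0 = count (mem TT) (take k L) & k < n -> t 24 0 = nth x L k].
suff [_ h1 h2 _] : Inv n (den (PFor 34 0 body) s1).
  split; last by rewrite h2 take_oversize // sL.
  move=> v; rewrite -{1}(nth_index x (all v)) h1 //.
  have h : index v L < size L by rewrite index_mem; exact: all.
  by move: h; rewrite [X in _ < X]sL.
apply: (for_rule (Inv := Inv)) => //.
- by rewrite /s1 /= !update_other // s0 inp0.
- by split=> //; rewrite x0.
move=> k t kn tk _ [[t6 t14] h1 h2 /(_ kn) h3].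
have kL : k < size L by rewrite sL.
split.
- by rewrite !den_frame.
- move=> i; rewrite ltnS leq_eqVlt /= /update /= h3 => /orP[/eqP->|ik].
    by rewrite eqxx h2.
  have il : i < size L by apply: ltn_trans ik _.
  rewrite (inj_eq val_inj) nth_uniq // (ltn_eqF ik); exact: h1.
- by rewrite (take_nth x kL) -cats1 count_cat -h2 /= /update /= h3 t14 hT addn0.
move=> kn1; rewrite /= /update /= h3 t6.
have kp : k < size p by move: sL kn1; rewrite /L /=; clear; lia.
by have /(pathP x)/(_ k kp)/eqP-> := pp.
Qed.

End Phase1.

(** * Selection of the sinks *)

(** Cell 27 sums up by how much each selected vertex falls short of distance m from the candidate;
    truncation makes each shortfall nonnegative, so the sum is 0 only if there is no conflict. *)
Definition gap_scan : prg :=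
  PFor 43 0 (pif (Cell 8 (scal 43)) [:: pset 27 (Plus (scal 27)
    (Minus (scal 21) (differ (Cell 7 (scal 42)) (Cell 7 (scal 43)))))]).

Definition try_select : prg :=
  pif (terminal (scal 41) (scal 42)) [::
    pset 27 (Minus (Plus (Cell 7 (scal 42)) (scal 21)) (scal 25));
    gap_scan;
    pifnot (scal 27) [::
      PAssign 8 (scal 42) (Plus (scal 41) (Const 1)); pset 26 (Const 1) ]].

Section Select.
Variables (n r : nat) (T : 'I_r -> {set 'I_n}).
Variables (inp rb ix : nat -> nat) (m tot : nat).
Hypotheses (inp0 : inp 0 = n) (inp1 : inp 1 = r).
Hypothesis inp_T : forall (j : 'I_r) (x : 'I_n),
  inp (4 + n * n + (j * n + x)) = (x \in T j).
Hypothesis rbE : forall u, u <= n \/ u < r -> rb u = u * n.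
Hypothesis m_gt0 : 0 < m.

Let TT := \bigcup_j T j.
Hypothesis ix_inj : {in TT &, injective (fun x : 'I_n => ix x)}.
Hypothesis ix_lt : forall x : 'I_n, x \in TT -> ix x < tot.

Definition close (x y : 'I_n) : Prop := ix x < ix y + m /\ ix y < ix x + m.

(** Label 0 means unselected. Since a vertex carries one label, the sets are disjoint. *)
Record selected (lab : nat -> nat) (Y : 'I_r -> {set 'I_n}) : Prop := Selected {
  sel_lab : forall (j : 'I_r) (x : 'I_n), (x \in Y j) = (lab x == j.+1);
  sel_range : forall x : 'I_n, lab x <= r;
  sel_sub : forall j, Y j \subset T j;
  sel_end : forall j x, x \in Y j -> ix x + m <= tot;
  sel_gap : forall i j x y, x \in Y i -> y \in Y j -> x != y -> ~ close x y
}.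

Lemma terminalP (t : store) (j : 'I_r) (x : 'I_n) (a b : expr) :
  t 0 = inp -> t 3 = rb -> eval t a = j -> eval t b = x ->
  eval t (terminal a b) = (x \in T j).
Proof.
move=> t0 t3 ha hb; rewrite /= ha hb t0 t3 inp0 !rbE; [|by right|by left].
exact: inp_T.
Qed.

Lemma gap_scanP (t : store) (x : 'I_n) : t 0 0 = n -> t 7 = ix -> t 21 0 = m ->
  t 42 0 = x ->
  (den gap_scan t 27 0 == 0) =
    (t 27 0 == 0) && [forall y : 'I_n, (t 8 y == 0) ||
       (m <= (ix x - ix y) + (ix y - ix x))].
Proof.
move=> t0 t7 t21 t42.
pose Inv k (u : store) := [/\ u 7 = ix, u 21 0 = m, u 42 0 = x, u 8 = t 8 &
  (u 27 0 == 0) = (t 27 0 == 0) && [forall y : 'I_n, (k <= y) || (t 8 y == 0) ||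
       (m <= (ix x - ix y) + (ix y - ix x))]].
suff [_ _ _ _ ->] : Inv n (den gap_scan t).
  by congr (_ && _); apply: eq_forallb => y; rewrite leqNgt ltn_ord.
apply: (for_rule (Inv := Inv)) => //.
- split=> //; rewrite -[LHS]andbT; congr (_ && _); apply/esym/forallP => y.
  by rewrite leq0n.
move=> k u kn uk _ [u7 u21 u42 u8 hu].
have key : [forall y : 'I_n, (k.+1 <= y) || (t 8 y == 0) ||
       (m <= (ix x - ix y) + (ix y - ix x))] =
  [forall y : 'I_n, (k <= y) || (t 8 y == 0) ||
       (m <= (ix x - ix y) + (ix y - ix x))] &&
  ((t 8 k == 0) || (m <= (ix x - ix k) + (ix k - ix x))).
  apply/forallP/andP => [h|[/forallP h1 h2] y]; last first.
    case: (ltngtP k y) => [//|yk|<- //].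
    by have := h1 y; rewrite leqNgt yk.
  split; last by have := h (Ordinal kn); rewrite /= ltnn.
  apply/forallP => y; case: (ltngtP k y) => [//|yk|//].
  by have := h y; rewrite ltnNge ltnW.
rewrite den_pif /= uk u8.
case: ifP => h8.
  split=> //; rewrite /update /= ?u21 ?u42 ?u7 ?uk addn_eq0 hu key andbA.
  by rewrite (negPf h8) subn_eq0.
by split=> //; rewrite hu key; move/negbFE: h8 => ->; rewrite andbT.
Qed.

Let St (s : store) Y := [/\ s 0 = inp, s 3 = rb, s 7 = ix, s 21 0 = m /\ s 25 0 = tot &
  selected (s 8) Y].

Let blocked (j : 'I_r) (x : 'I_n) (Y : 'I_r -> {set 'I_n}) := x \in T j ->
  tot < ix x + m \/ exists2 y, y \in \bigcup_i Y i & close x y.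

Lemma try_selectP s Y (j : 'I_r) (x : 'I_n) :
  St s Y -> s 41 0 = j -> s 42 0 = x -> s 26 0 = 0 ->
  let s' := den try_select s in
  [/\ s' 26 0 != 0, x \notin Y j & St s' (enlarge Y j x)] \/
  [/\ s' 26 0 = 0, St s' Y & blocked j x Y].
Proof.
move=> [s0 s3 s7 [s21 s25] [l1 l2 l3 l4 l5]] sj sx s26.
rewrite /try_select den_pif (@terminalP s j x) //.
case: (boolP (x \in T j)) => xT; last first.
  by rewrite eqxx /=; right; split=> // h; rewrite h in xT.
rewrite [1 != 0]/= 3!den_pseq den_pseq0.
set s1 := den (pset 27 _) s.
have s1b : s1 27 0 = ix x + m - tot by rewrite /s1 /= /update /= sx s7 s21 s25.
have fr1 k : k != 27 -> s1 k = s k by move=> h; rewrite /s1 /= update_other.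
clearbody s1; have := @gap_scanP s1 x; rewrite (fr1 0) // (fr1 7) // (fr1 21) // (fr1 42) // s0 => /(_ inp0 s7 s21 sx).
set s2 := den gap_scan s1; rewrite s1b => s2b.
have fr2 k : k \notin [:: 43; 27] -> s2 k = s k.
  by move=> h; rewrite /s2 den_frame // fr1 //; move: h; rewrite !inE negb_or => /andP[].
clearbody s2.
have labY (y : 'I_n) : s 8 y != 0 -> y \in \bigcup_i Y i.
  move=> hy; have ly := l2 y.
  have lr : (s 8 y).-1 < r by move: hy ly; clear; lia.
  apply/bigcupP; exists (Ordinal lr) => //; rewrite l1 /=.
  by move: hy; clear; lia.
case: (eqVneq (s2 27 0) 0) => [z|z]; last first.
  right; rewrite den_pifnot_true //; split; rewrite ?fr2 //.
    by split; rewrite ?fr2.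
  move=> _; move: z; rewrite s2b negb_and => /orP[z|/forallPn[y]].
    by left; move: z; clear; lia.
  rewrite negb_or fr1 // => /andP[hy hd]; right; exists y; first exact: labY.
  by rewrite /close; move: hd; clear; lia.
left; rewrite den_pifnot_false // 2!den_pseq den_pseq0.
move/eqP: z; rewrite s2b => /andP[z /forallP hgap].
have endx : ix x + m <= tot by move: z; clear; lia.
have nclose y : y \in \bigcup_i Y i -> ~ close x y.
  case/bigcupP=> i _ yi [h1 h2]; have := hgap y; rewrite fr1 //.
  have := l1 i y; rewrite yi => /esym/eqP->; rewrite /=.
  by move: h1 h2; clear; lia.
(* As m > 0, a vertex is close to itself, so a selected one cannot pass again. *)
have xY i : x \notin Y i.
  apply/negP => xi; apply: (nclose x); first by apply/bigcupP; exists i.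
  by split; rewrite -addn1 leq_add2l.
have lab0 : s 8 x = 0.
  by apply/eqP/negPn/negP => /labY/bigcupP[i _]; apply/negP.
split=> //; split.
- by rewrite /= !update_other // fr2.
- by rewrite /= !update_other // fr2.
- by rewrite /= !update_other // fr2.
- by rewrite /= !update_other // !fr2.
have E (y : 'I_n) : den (pset 26 (Const 1)) (den (PAssign 8 (scal 42) (Plus (scal 41) (Const 1))) s2) 8 y =
    if y == x then j.+1 else s 8 y.
  by rewrite /= /update /= !fr2 // sj sx addn1 -val_eqE.
split.
- move=> i y; rewrite E /enlarge; case: (altP (i =P j)) => [->|ij].
    by rewrite !inE; case: (altP (y =P x)) => [_|yx]; rewrite ?eqxx ?l1.
  case: (altP (y =P x)) => [->|yx]; rewrite ?l1 // lab0 eq_sym /=.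
  by apply/esym/negbTE; rewrite eqSS eq_sym.
- by move=> y; rewrite E; case: ifP.
- move=> i; rewrite /enlarge; case: (altP (i =P j)) => [->|//].
  by apply/subsetP => y; rewrite !inE => /orP[/eqP->//|]; apply/subsetP.
- move=> i y; rewrite /enlarge; case: (altP (i =P j)) => [->|_]; last exact: l4.
  by rewrite !inE => /orP[/eqP->//|]; apply: l4.
have inY i y : y \in enlarge Y j x i -> y = x \/ y \in \bigcup_i Y i.
  rewrite /enlarge; case: (altP (i =P j)) => [->|_].
    rewrite !inE => /orP[/eqP->|yj]; [by left|by right; apply/bigcupP; exists j].
  by move=> yi; right; apply/bigcupP; exists i.
move=> i i' y z' /inY[->|yY] /inY[->|zY] yz hc.
- by rewrite eqxx in yz.
- exact: nclose zY hc.
- by apply: nclose yY _; case: hc.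
by case/bigcupP: yY zY => k _ yk /bigcupP[k' _ zk]; exact: l5 yk zk yz hc.
Qed.

Lemma selectP s : s 0 = inp -> s 3 = rb -> s 7 = ix -> s 21 0 = m -> s 25 0 = tot ->
  (forall x : 'I_n, s 8 x = 0) ->
  exists2 Y, selected (den (round_robin try_select) s 8) Y &
    forall j, #|T j| <= m + 2 * m * (r * #|Y j|.+1).
Proof.
move=> s0 s3 s7 s21 s25 s8.
have [Y [_ _ _ _ hY] bY] : exists2 Y, St (den (round_robin try_select) s) Y &
    forall j, #|T j| <= m + 2 * m * (r * #|Y j|.+1).
  apply: (@round_robinP n r try_select St blocked) => //.
  - move=> t Y k i v; rewrite !inE.
    case/or4P => /eqP->; case=> h1 h2 h3 h4 h5;
      by split; rewrite ?update_other.
  - exact: try_selectP.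
  - move=> t Y j [_ _ _ _ hY] hb.
    apply: leq_trans (_ : m + 2 * m * #|\bigcup_i Y i| <= _).
      apply: (@card_close _ TT _ (fun x : 'I_n => ix x) m tot).
      + exact: ix_inj.
      + exact: (bigcup_sup j).
      + by move=> x xj; apply: ix_lt; apply/bigcupP; exists j.
      by move=> x xj; apply: hb.
    rewrite leq_add2l leq_mul2l; apply/orP; right.
    elim/big_rec2: _ => [|i k A _ Ak]; first by rewrite cards0.
    by apply: leq_trans (leq_card_setU _ _) _; rewrite leq_add2l.
  - by move=> j; rewrite -[X in _ <= X]card_ord max_card.
  - by rewrite muln_gt0 m_gt0.
  - by rewrite s0.
  - by rewrite s0.
  split=> //; split=> //.
  - by move=> j x; rewrite s8 inE.
  - by move=> x; rewrite s8.
  - by move=> j; rewrite sub0set.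
  - by move=> j x; rewrite inE.
  - by move=> i j x y; rewrite inE.
by exists Y.
Qed.

End Select.

(** * Capacities *)

Definition set_entry (k : nat) (a b v : expr) : prg :=
  PAssign k (Plus (Cell 3 a) b) v.

(** The edge is removed, its second end is searched for from the first, and the edge is put back.
    With truncated subtraction, 2 - (1 - (1 - t)) is 2 for t = 0 and 1 for any other visiting time
    t. *)
Definition test_bridge : prg :=
  pseq [:: set_entry 2 (scal 44) (scal 45) (Const 0);
    set_entry 2 (scal 45) (scal 44) (Const 0);
    pset 23 (scal 44); search;
    set_entry 13 (scal 44) (scal 45) (Minus (Const 2) (Minus (Const 1) (Minus (Const 1) (Cell 4 (scal 45)))));
    set_entry 2 (scal 44) (scal 45) (Const 1);
    set_entry 2 (scal 45) (scal 44) (Const 1)].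

Definition capacities : prg :=
  PFor 44 0 (PFor 45 0 (PIf (entry 2 (scal 44) (scal 45)) test_bridge
    (set_entry 13 (scal 44) (scal 45) (Const 0)))).

Definition init_flow : prg :=
  pseq [:: fill_mat 2 (entry 13 (scal 36) (scal 37));
    fill_vec 9 (Minus (Const 1) (Minus (Const 1) (Cell 8 (scal 36))))].

Lemma entries_set n (s : store) k (a b : expr) (u v : 'I_n) (w : expr) :
  k != 3 -> s 3 (eval s a) = u * n -> eval s b = v ->
  forall x y : 'I_n, entries (den (set_entry k a b w) s k) x y =
    if (x, y) == (u, v) then eval s w else entries (s k) x y.
Proof.
move=> k3 ha hb x y; rewrite /entries /set_entry /= /update eqxx ha hb /=.
by rewrite pair_index_eq.
Qed.

Section Capacities.
Variables (n : nat) (e : rel 'I_n).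
Hypotheses (e_sym : symmetric e) (e_irr : irreflexive e).

Let ew (x y : 'I_n) : nat := e x y.

Definition bridge (u v : 'I_n) : bool :=
  [exists D : {set 'I_n}, [&& u \in D, v \notin D & cut ew D == 1]].

Definition capacity (u v : 'I_n) : nat := e u v * (bridge u v).+1.

Lemma bridge_sym u v : bridge u v = bridge v u.
Proof.
suff H x y : bridge x y -> bridge y x by apply/idP/idP; apply: H.
case/existsP=> D /and3P[xD yD c1]; apply/existsP; exists (~: D).
rewrite !inE yD xD cut_setC // => a b; by rewrite /ew e_sym.
Qed.

Lemma capacity_sym u v : capacity u v = capacity v u.
Proof. by rewrite /capacity e_sym bridge_sym. Qed.

Lemma capacity_bound u v : e u v <= capacity u v <= 2 * e u v.
Proof. by rewrite /capacity; case: (e u v); case: (bridge u v). Qed.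

Lemma capacity_bridge u v : capacity u v = 2 ->
  exists2 D : {set 'I_n}, u \in D /\ v \notin D & cut ew D = 1.
Proof.
rewrite /capacity; case: (boolP (bridge u v)) => [|_]; last by case: (e u v).
by case/existsP=> D /and3P[uD vD /eqP c1] _; exists D.
Qed.

Hypothesis e_conn : forall x y : 'I_n, connect e x y.

Lemma capacity_nonbridge u v : capacity u v = 1 ->
  forall D : {set 'I_n}, u \in D -> v \notin D -> 1 < cut ew D.
Proof.
rewrite /capacity; case: (boolP (bridge u v)) => [_|nb]; first by case: (e u v).
move=> _ D uD vD; rewrite ltn_neqAle cut_gt0 //.
- rewrite andbT eq_sym; apply: contra nb => c1; apply/existsP; exists D.
  by rewrite uD vD.
- by apply/set0Pn; exists u.
by apply: contraNneq vD => ->; rewrite inE.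
Qed.

Variables (inp rb : nat -> nat).
Hypotheses (inp0 : inp 0 = n) (rbE : forall u : 'I_n, rb u = u * n).

(** Without its single leaving edge, a set [D] cannot be left by the search, by induction on
    visiting times. Conversely, if [v] is not reached, the removed edge is the only one that leaves
    the visited set. *)
Lemma bridge_search R vis par nxt cnt (u v : 'I_n) p : e u v ->
  (forall x y : 'I_n, entries R x y =
     if ((x, y) == (u, v)) || ((x, y) == (v, u)) then 0 else e x y) ->
  searched R vis par nxt cnt u p -> closed_under R (u :: p) ->
  bridge u v = (v \notin u :: p).
Proof.
move=> euv hR hs hc.
have uv : u != v by apply: contraTneq euv => ->; rewrite e_irr.
apply/existsP/idP => [[D /and3P[uD vD /eqP c1]]|vp].
  apply: contra (vD) => vp.
  have H k : forall w : 'I_n, vis w < k -> w \in u :: p -> w \in D.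
    elim: k => // k IHk w wk; rewrite in_cons => /orP[/eqP->//|wp].
    have [a [_ ap aw]] := sr_par hs wp; rewrite hR.
    case: ifP => // /norP[/negPf h1 _] eaw.
    have aD : a \in D by apply: IHk ap; apply: leq_trans aw _.
    apply/negPn/negP => wD.
    have eaw' : e a w by move: eaw; case: (e a w).
    by have := cut1_unique c1 uD vD euv aD wD eaw' => h2; rewrite h2 eqxx in h1.
  exact: (H (vis v).+1).
exists [set w in u :: p]; rewrite !inE -!in_cons mem_head vp /=.
rewrite /cut /weight (bigD1 (u, v)) //= big1 ?addn0.
  by rewrite !inE -!in_cons mem_head vp /ew euv.
move=> [x y] /= hxy; rewrite !inE -!in_cons.
case: (boolP (x \in u :: p)) => // xp; case: (boolP (y \in u :: p)) => // yp.
suff -> : ew x y = 0 by rewrite muln0.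
apply/eqP; rewrite eqb0; apply: contra yp => exy; apply: (hc x) => //.
rewrite hR (negPf hxy) /=; case: eqP => [[xv _]|_]; last by rewrite exy.
by rewrite -xv xp in vp.
Qed.

Lemma test_bridgeP (t : store) (u v : 'I_n) : t 0 = inp -> t 3 = rb ->
  t 44 0 = u -> t 45 0 = v -> e u v ->
  (forall x y : 'I_n, entries (t 2) x y = e x y) ->
  let t' := den test_bridge t in
  (forall x y : 'I_n, entries (t' 2) x y = e x y) /\
  forall x y : 'I_n, entries (t' 13) x y =
    if (x, y) == (u, v) then capacity u v else entries (t 13) x y.
Proof.
move=> t0 t3 tu tv euv te; rewrite /test_bridge 7!den_pseq den_pseq0.
have uv : u != v by apply: contraTneq euv => ->; rewrite e_irr.
set t1 := den (set_entry 2 (scal 44) (scal 45) (Const 0)) t.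
have f1 k : k != 2 -> t1 k = t k by move=> h; rewrite /t1 /= update_other.
have t1e (x y : 'I_n) : entries (t1 2) x y = if (x, y) == (u, v) then 0 else e x y.
  rewrite /t1 (@entries_set n t 2 _ _ u v) //; first by rewrite te.
  by rewrite /= tu t3 rbE.
clearbody t1; set t2 := den (set_entry 2 (scal 45) (scal 44) (Const 0)) t1.
have f2 k : k != 2 -> t2 k = t k by move=> h; rewrite /t2 /= update_other // f1.
have t2e (x y : 'I_n) : entries (t2 2) x y =
    if ((x, y) == (u, v)) || ((x, y) == (v, u)) then 0 else e x y.
  rewrite /t2 (@entries_set n t1 2 _ _ v u) //.
  - by rewrite t1e; case: ((x, y) == (v, u)); rewrite ?orbT ?orbF.
  - by rewrite /= (f1 3) // (f1 45) // tv t3 rbE.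
  - by rewrite /= (f1 44).
clearbody t2; set t3' := den (pset 23 (scal 44)) t2.
have f3 k : k \notin [:: 2; 23] -> t3' k = t k.
  by rewrite !inE negb_or => /andP[h1 h2]; rewrite /t3' /= update_other // f2.
have t3x : t3' 23 0 = u by rewrite /t3' /= /update /= f2.
have t32 : t3' 2 = t2 2 by rewrite /t3' /= update_other.
clearbody t3'; have p0 : t3' 0 0 = n by rewrite f3 // t0.
have pr (x : 'I_n) : t3' 3 x = x * n by rewrite f3 // t3.
have [p [hs hc]] := searchP p0 t3x pr.
set t4 := den search t3' in hs *.
have f4 k : k \notin [:: 2; 23] -> k \notin writes search -> t4 k = t k.
  by move=> h1 h2; rewrite /t4 den_frame // f3.
have t42 : t4 2 = t2 2 by rewrite /t4 den_frame.
clearbody t4; rewrite t32 in hs hc.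
have cE : 2 - (1 - (1 - t4 4 v)) = capacity u v.
  rewrite /capacity euv (bridge_search euv t2e hs hc) -(sr_vis hs v) mul1n.
  by case: (t4 4 v).
set t5 := den (set_entry 13 _ _ _) t4.
have t5e (x y : 'I_n) : entries (t5 13) x y =
    if (x, y) == (u, v) then capacity u v else entries (t 13) x y.
  rewrite /t5 (@entries_set n t4 13 _ _ u v) //.
  - by rewrite (f4 13) // /= (f4 45) // tv cE.
  - by rewrite /= (f4 3) // (f4 44) // tu t3 rbE.
  - by rewrite /= (f4 45).
have f5 k : k != 13 -> t5 k = t4 k by move=> h; rewrite /t5 /= update_other.
clearbody t5; set t6 := den (set_entry 2 _ _ _) t5.
have t6e (x y : 'I_n) : entries (t6 2) x y = if (x, y) == (v, u) then 0 else e x y.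
  rewrite /t6 (@entries_set n t5 2 _ _ u v) //.
  - rewrite (f5 2) // t42 t2e; case: ((x, y) =P (u, v)) => [[-> ->]|_] //=.
    by rewrite xpair_eqE (negPf uv) euv.
  - by rewrite /= (f5 3) // (f5 44) // (f4 3) // (f4 44) // tu t3 rbE.
  - by rewrite /= (f5 45) // (f4 45).
have f6 k : k != 2 -> t6 k = t5 k by move=> h; rewrite /t6 /= update_other.
clearbody t6; set t7 := den (set_entry 2 _ _ _) t6.
have t7e (x y : 'I_n) : entries (t7 2) x y = e x y.
  rewrite /t7 (@entries_set n t6 2 _ _ v u) //.
  - by rewrite t6e; case: ((x, y) =P (v, u)) => [[-> ->]|_] //=; rewrite e_sym euv.
  - by rewrite /= (f6 3) // (f6 45) // (f5 3) // (f5 45) // (f4 3) // (f4 45) // tv t3 rbE.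
  - by rewrite /= (f6 44) // (f5 44) // (f4 44).
have f7 k : k != 2 -> t7 k = t6 k by move=> h; rewrite /t7 /= update_other.
by split=> // x y; rewrite f7 // f6.
Qed.

Lemma capacitiesP (s : store) : s 0 = inp -> s 3 = rb ->
  (forall x y : 'I_n, entries (s 2) x y = e x y) ->
  forall x y : 'I_n, entries (den capacities s 13) x y = capacity x y.
Proof.
move=> s0 s3 se.
pose base (t : store) := [/\ t 0 = inp, t 3 = rb & forall x y : 'I_n, entries (t 2) x y = e x y].
pose outer k (t : store) := base t /\
  forall x y : 'I_n, x < k -> entries (t 13) x y = capacity x y.
suff [_ h] : outer n (den capacities s) by move=> x y; apply: h.
apply: (for_rule (Inv := outer)) => //; first by rewrite s0.
move=> k t kn tk _ [[t0 t3 te] h].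
pose inner l (t : store) := [/\ base t, t 44 0 = k &
  forall x y : 'I_n, (x < k) || (x == k :> nat) && (y < l) ->
    entries (t 13) x y = capacity x y].
set body := PIf _ _ _.
suff [h1 _ h2] : inner n (den (PFor 45 0 body) t).
  split=> // x y xk; apply: h2; rewrite ltn_ord andbT.
  by move: xk; clear; lia.
apply: (for_rule (Inv := inner)) => //; first by rewrite t0.
  by split=> // x y; rewrite andbF orbF; apply: h.
move=> l t1 ln t1l _ [[g0 g3 ge] gk gc].
pose u := Ordinal kn; pose v := Ordinal ln.
have step : den body t1 0 = inp /\ den body t1 3 = rb /\ den body t1 44 0 = k /\
    (forall x y : 'I_n, entries (den body t1 2) x y = e x y) /\
  forall x y : 'I_n, entries (den body t1 13) x y =
    if (x, y) == (u, v) then capacity u v else entries (t1 13) x y.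
  have tE : eval t1 (entry 2 (scal 44) (scal 45)) = e u v.
    by rewrite /= gk t1l g3 (rbE u); apply: (ge u v).
  have bE : den body t1 = if e u v then den test_bridge t1 else
      den (set_entry 13 (scal 44) (scal 45) (Const 0)) t1.
    have -> : den body t1 = if eval t1 (entry 2 (scal 44) (scal 45)) != 0 then
      den test_bridge t1 else den (set_entry 13 (scal 44) (scal 45) (Const 0)) t1 by [].
    by rewrite tE; case: (e u v).
  rewrite bE; case: ifP => euv.
    have [q1 q2] := test_bridgeP (v := v) (u := u) g0 g3 gk t1l euv ge.
    by do 3!(split; first by rewrite den_frame).
  split; first by rewrite /= update_other.
  split; first by rewrite /= update_other.
  split; first by rewrite /= update_other.
  split; first by rewrite /= update_other.
  move=> x y; rewrite (@entries_set n t1 13 _ _ u v) //=; last by rewrite gk g3 (rbE u).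
  by rewrite /capacity euv.
move: (den body t1) step => t2 [q0 [q3 [qk [qe qc]]]].
split=> // x y xy; rewrite qc; case: eqP => [[-> ->]//|hne]; apply: gc.
have hne' : ~ (x = k :> nat /\ y = l :> nat).
  by case=> hx hy; apply: hne; congr (_, _); apply: val_inj.
by move: xy hne'; clear; lia.
Qed.

Lemma init_flowP (s : store) (S : {set 'I_n}) : s 0 = inp -> s 3 = rb ->
  (forall x y : 'I_n, entries (s 13) x y = capacity x y) ->
  (forall x : 'I_n, (x \in S) = (s 8 x != 0)) ->
  flow_at capacity S (den init_flow s) (fun _ => 0).
Proof.
move=> s0 s3 sc sS; rewrite /init_flow 2!den_pseq den_pseq0.
set s1 := den (fill_mat 2 _) s.
have f1 k : k \notin [:: 36; 37; 2] -> s1 k = s k by move=> h; rewrite /s1 den_frame.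
have s1e (x y : 'I_n) : entries (s1 2) x y = capacity x y.
  apply: (@fill_matP n capacity) => //; rewrite ?s0 ?s3 //.
  by move=> t u v fr t36 t37; rewrite /= t36 t37 !fr // s3 rbE; apply: sc.
clearbody s1; set s2 := den (fill_vec 9 _) s1.
have s2v (v : 'I_n) : s2 9 v = (v \in S).
  rewrite /s2 (@fill_vecP n (fun v => nat_of_bool (s 8 v != 0))) //; first by rewrite sS.
    by rewrite f1 // s0.
  move=> t w wn fr t36; rewrite /= t36 fr // f1 //.
  by case: (s 8 w).
have f2 : s2 2 = s1 2 by rewrite /s2 den_frame.
move=> A; rewrite addn0 f2; congr (_ + _).
  by apply: eq_weight => x y _ _; rewrite s1e.
rewrite -sum1_card; under [RHS]eq_bigr => x _ do rewrite s2v.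
rewrite [LHS]big_mkcond [RHS]big_mkcond; apply: eq_bigr => x _.
by rewrite inE; case: (x \in A); case: (x \in S).
Qed.

End Capacities.

(** * Selection of the sources *)

Definition record_sent : prg :=
  pif (Minus (scal 29) (Const 2)) [::
    set_entry 1 (scal 41) (scal 42) (Const 1);
    pset 26 (Const 1); pset 15 (Const 1) ].

Definition try_send : prg :=
  pifnot (differ (Cell 8 (scal 42)) (Plus (scal 41) (Const 1))) [::
    pifnot (entry 1 (scal 41) (scal 42)) [::
      pset 23 (scal 42); send3; record_sent ]].

(** For r = 1 the logarithm vanishes and the size hypothesis allows tiny sets, so the selection may
    come out empty. A single vertex of the first set, trivially 1-well-linked, is then output. Its
    position in row 0 is its own number. *)
Definition fallback : prg :=
  PFor 34 0 (pifnot (scal 15) [:: pif (terminal (Const 0) (scal 34)) [::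
    PAssign 1 (scal 34) (Const 1); pset 15 (Const 1) ]]).

Section SendAll.
Variables (n r : nat) (Y : 'I_r -> {set 'I_n}) (c : 'I_n -> 'I_n -> nat).
Variables (inp rb lab : nat -> nat).
Hypotheses (inp0 : inp 0 = n) (inp1 : inp 1 = r).
Hypothesis rbE : forall u, u <= n \/ u < r -> rb u = u * n.
Hypothesis labE : forall (j : 'I_r) (x : 'I_n), (x \in Y j) = (lab x == j.+1).

Let S := \bigcup_j Y j.
Implicit Types X : 'I_r -> {set 'I_n}.

Hypothesis bound : forall U Z : {set 'I_n},
  (forall A : {set 'I_n}, 3 * #|A :&: U| <= cut c A + #|A :&: S|) -> Z \subset S ->
  (forall z, z \in Z -> z \notin U -> exists2 A : {set 'I_n}, z \in A &
     cut c A + #|A :&: S| <= 3 * #|A :&: U| + 2) ->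
  (#|S| <= #|Z| + 2 + 18 * #|U|) || (#|Z| <= 40 * #|U|).

Record sent (out : nat -> nat) (any : nat) X : Prop := Sent {
  sent_out : forall (j : 'I_r) (x : 'I_n), (x \in X j) = (out (j * n + x) != 0);
  sent_sub : forall j, X j \subset Y j;
  sent_any : (any == 0) = (\bigcup_j X j == set0)
}.

Let St (s : store) X := [/\ s 0 = inp, s 3 = rb, s 8 = lab,
  flow_at c S s (fun A => 3 * #|A :&: \bigcup_j X j|) & sent (s 1) (s 15 0) X].

Let blocked (j : 'I_r) (x : 'I_n) X := x \in Y j -> x \notin X j ->
  exists2 A : {set 'I_n}, x \in A &
    cut c A + #|A :&: S| <= 3 * #|A :&: \bigcup_j X j| + 2.

Lemma bigcup_enlarge X j x :
  \bigcup_i enlarge X j x i = x |: \bigcup_i X i.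
Proof.
apply/setP => y; rewrite !inE; apply/bigcupP/orP.
  case=> i _; rewrite /enlarge; case: (altP (i =P j)) => [->|_].
    by rewrite !inE => /orP[->|h]; [left|right; apply/bigcupP; exists j].
  by move=> h; right; apply/bigcupP; exists i.
case=> [/eqP->|/bigcupP[i _ yi]]; first by exists j; rewrite // /enlarge eqxx !inE eqxx.
by exists i => //; rewrite /enlarge; case: ifP => // _; rewrite !inE yi orbT.
Qed.

Lemma Y_disjoint i j x : x \in Y i -> x \in Y j -> i = j.
Proof.
by rewrite !labE => /eqP-> /eqP[h]; apply: val_inj.
Qed.

Lemma try_sendP s X (j : 'I_r) (x : 'I_n) :
  St s X -> s 41 0 = j -> s 42 0 = x -> s 26 0 = 0 ->
  let s' := den try_send s in
  [/\ s' 26 0 != 0, x \notin X j & St s' (enlarge X j x)] \/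
  [/\ s' 26 0 = 0, St s' X & blocked j x X].
Proof.
move=> hSt sj sx s26; have [s0 s3 s8 sf [o1 o2 o3]] := hSt.
rewrite /try_send.
have e1 : eval s (differ (Cell 8 (scal 42)) (Plus (scal 41) (Const 1))) =
    (lab x - j.+1) + (j.+1 - lab x) by rewrite /= sj sx s8 addn1.
case: (boolP (x \in Y j)) => xY; last first.
  right; rewrite den_pifnot_true; first by split=> // h; rewrite h in xY.
  by rewrite e1; move: xY; rewrite labE; clear; lia.
rewrite den_pifnot_false; last first.
  by rewrite e1; move: xY; rewrite labE; clear; lia.
rewrite den_pseq den_pseq0.
have e2 : eval s (entry 1 (scal 41) (scal 42)) = s 1 (j * n + x).
  by rewrite /= sj sx s3 rbE //; right.
case: (boolP (x \in X j)) => xX.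
  right; rewrite den_pifnot_true; first by split=> // _; rewrite xX.
  by rewrite e2 -o1.
rewrite den_pifnot_false; last by rewrite e2; apply/eqP; rewrite -[_ == _]negbK -o1.
rewrite 3!den_pseq den_pseq0; set s1 := den (pset 23 _) s.
have f1 k : k != 23 -> s1 k = s k by move=> h; rewrite /s1 /= update_other.
have s1x : s1 23 0 = x by rewrite /s1 /= /update /= sx.
have s1f : flow_at c S s1 (fun A => 3 * #|A :&: \bigcup_j X j|).
  by apply: eq_flow_at sf => // *; rewrite f1.
clearbody s1.
have p0 : s1 0 0 = n by rewrite f1 // s0.
have pr (u : 'I_n) : s1 3 u = u * n by rewrite f1 // s3 rbE //; left; exact: ltnW.
have := send3P p0 pr s1x s1f; set s2 := den send3 s1; cbv zeta => hs2.
have f2 k : k \notin [:: 23] -> k \notin writes send3 -> s2 k = s k.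
  by move=> h1 h2; rewrite /s2 den_frame // f1 //; move: h1; rewrite inE.
have [g0 [g3 [g8 [g1 [g15 [g41 [g42 g26]]]]]]] : s2 0 = s 0 /\ s2 3 = s 3 /\ s2 8 = s 8 /\
    s2 1 = s 1 /\ s2 15 = s 15 /\ s2 41 = s 41 /\ s2 42 = s 42 /\ s2 26 = s 26.
  by do 7!(split; first by apply: f2); apply: f2.
clearbody s2; rewrite /record_sent den_pif.
case: hs2 => [[h29 hf]|[h29 hf hA]]; last first.
  have -> : eval s2 (Minus (scal 29) (Const 2)) = 0 by apply/eqP; rewrite subn_eq0.
  rewrite eqxx /=; right; split=> //; first by rewrite g26.
  by split=> //; rewrite ?g0 ?g3 ?g8 // g1 g15; split.
have -> : (eval s2 (Minus (scal 29) (Const 2)) != 0) by rewrite -lt0n subn_gt0.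
rewrite 3!den_pseq den_pseq0; set s3' := den (set_entry 1 _ _ _) s2.
have s3o (k : 'I_r) (y : 'I_n) : s3' 1 (k * n + y) =
    if (k == j) && (y == x) then 1 else s 1 (k * n + y).
  rewrite /s3' /= /update /= g3 g41 g42 g1 sj sx s3 rbE; last by right.
  by rewrite index_eq.
have f3 k : k != 1 -> s3' k = s2 k by move=> h; rewrite /s3' /= update_other.
clearbody s3'; set s4 := den (pset 15 _) _.
have f4 k : k \notin [:: 15; 26] -> s4 k = s3' k.
  by rewrite !inE negb_or => /andP[h1 h2]; rewrite /s4 /= !update_other.
have s426 : s4 26 0 = 1 by [].
have s415 : s4 15 0 = 1 by [].
clearbody s4; left.
have xU : x \notin \bigcup_i X i.
  apply/negP => /bigcupP[i _ xi]; have xYi := subsetP (o2 i) _ xi.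
  by rewrite (Y_disjoint xYi xY) (negPf xX) in xi.
split=> //; first by rewrite s426.
split; rewrite ?(f4 0) ?(f4 3) ?(f4 8) ?(f4 1) // ?(f3 0) ?(f3 3) ?(f3 8) //.
- by rewrite g0.
- by rewrite g3.
- by rewrite g8.
- apply: eq_flow_at hf => [u v|v|A]; rewrite ?f4 ?f3 //.
  rewrite bigcup_enlarge setIUr.
  case: (boolP (x \in A)) => xA.
    have -> : A :&: [set x] = [set x] by apply/setIidPr; rewrite sub1set.
    by rewrite cardsU1 inE (negPf xU) andbF /=; clear; lia.
  have -> : A :&: [set x] = set0 by apply/setP => y; rewrite !inE; case: eqP => [->|]; rewrite ?(negPf xA) ?andbF.
  by rewrite set0U addn0.
split.
- move=> k y; rewrite s3o /enlarge; case: (altP (k =P j)) => [->|_] /=; last exact: o1.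
  by rewrite !inE; case: eqP => //= _; apply: o1.
- move=> i; rewrite /enlarge; case: (altP (i =P j)) => [->|//].
  by apply/subsetP => y; rewrite !inE => /orP[/eqP->//|]; apply/subsetP.
rewrite s415 bigcup_enlarge /=; apply/esym/negbTE/set0Pn; exists x.
by rewrite !inE eqxx.
Qed.

Lemma send_allP s : s 0 = inp -> s 3 = rb -> s 8 = lab ->
  flow_at c S s (fun _ => 0) -> (forall i, s 1 i = 0) -> s 15 0 = 0 ->
  let s' := den (round_robin try_send) s in
  exists2 X, [/\ sent (s' 1) (s' 15 0) X,
      forall A : {set 'I_n}, 3 * #|A :&: \bigcup_j X j| <= cut c A + #|A :&: S| &
      s' 0 = inp /\ s' 3 = rb] &
    forall j, #|Y j| <= 4 + 80 * (r * #|X j|.+1).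
Proof.
move=> s0 s3 s8 sf s1 s15.
have [X [h0 h3 _ hf hX] bX] : exists2 X, St (den (round_robin try_send) s) X &
    forall j, #|Y j| <= 4 + 80 * (r * #|X j|.+1).
  apply: (@round_robinP n r try_send St blocked) => //.
  - move=> t X k i v; rewrite !inE.
    by case/or4P => /eqP->; case=> h1 h2 h3 h4 h5; split.
  - exact: try_sendP.
  - move=> t X j [_ _ _ tf [_ tX _]] hb.
    pose U := \bigcup_i X i.
    have Ule : #|U| <= \sum_i #|X i|.
      rewrite /U; elim/big_rec2: _ => [|i k A _ Ak]; first by rewrite cards0.
      by apply: leq_trans (leq_card_setU _ _) _; rewrite leq_add2l.
    (* Only half of [Y j] is used as [Z], so that both alternatives of [bound] limit [#|Y j|]: in
       the first, the other half lies in [S] outside [Z]. *)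
    have [q [uq sq qY]] : exists q, [/\ uniq q, size q = #|Y j|./2 & {subset q <= Y j}].
      by apply/card_geqP; rewrite -{2}(odd_double_half #|Y j|) -addnn addnA leq_addl.
    have YS : Y j \subset S by apply: bigcup_sup.
    have qc : #|[set y in q]| = #|Y j|./2 by rewrite cardsE (card_uniqP uq).
    have := @bound U [set y in q]; rewrite qc => hbd.
    have : (#|S| <= #|Y j|./2 + 2 + 18 * #|U|) || (#|Y j|./2 <= 40 * #|U|).
      apply: hbd.
      + by move=> A; rewrite (tf A) -addnA addnCA leq_addr.
      + by apply/subsetP => y; rewrite inE => /qY/(subsetP YS).
      move=> z; rewrite inE => /qY zY zU; apply: hb => //.
      by apply: contra zU => zX; apply/bigcupP; exists j.
    have := subset_leq_card YS; move: Ule.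
    by rewrite -{1 4}(odd_double_half #|Y j|) -muln2; clear; case: odd => /=; lia.
  - by move=> j; rewrite -[X in _ <= X]card_ord max_card.
  - by rewrite s0.
  - by rewrite s0.
  have U0 : \bigcup_(j < r) (set0 : {set 'I_n}) = set0 by rewrite big1.
  split=> //.
    apply: eq_flow_at sf => // A; by rewrite U0 setI0 cards0.
  split=> [j x|j|]; first by rewrite s1 inE.
    by rewrite sub0set.
  by rewrite s15 U0 !eqxx.
exists X => //; split=> // A.
by rewrite (hf A) -addnA addnCA leq_addr.
Qed.

End SendAll.

Section Fallback.
Variables (n r : nat) (T : 'I_r -> {set 'I_n}) (inp rb : nat -> nat).
Hypotheses (inp0 : inp 0 = n) (inp1 : inp 1 = r).
Hypothesis inp_T : forall (j : 'I_r) (x : 'I_n),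
  inp (4 + n * n + (j * n + x)) = (x \in T j).
Hypothesis rbE : forall u, u <= n \/ u < r -> rb u = u * n.

Lemma fallbackP (s : store) (j0 : 'I_r) : nat_of_ord j0 = 0 ->
  s 0 = inp -> s 3 = rb ->
  let s' := den fallback s in
  if s 15 0 != 0 then s' 1 = s 1 else
  (s' 1 = s 1 /\ T j0 = set0) \/
  exists2 x : 'I_n, x \in T j0 & forall i, s' 1 i = if i == x then 1 else s 1 i.
Proof.
move=> j00 s0 s3; cbv zeta.
pose Inv k (t : store) := [/\ t 0 = inp, t 3 = rb &
  if s 15 0 != 0 then t 15 0 != 0 /\ t 1 = s 1 else
  [/\ t 15 0 = 0, t 1 = s 1 & forall x : 'I_n, x < k -> x \notin T j0] \/
  t 15 0 != 0 /\ exists2 x : 'I_n, x \in T j0 &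
     forall i, t 1 i = if i == x then 1 else s 1 i].
suff [_ _] : Inv n (den fallback s).
  case: ifP => _; first by case.
  case=> [[_ h1 h2]|[_ h]]; [left; split=> //|by right].
  by apply/setP => x; rewrite inE; apply/negbTE/h2.
apply: (for_rule (Inv := Inv)) => //; first by rewrite s0.
  split=> //; case: ifP => h; first by split.
  by left; split=> //; apply/eqP; rewrite -[_ == _]negbK h.
move=> k t kn tk _ [t0 t3 ht].
case: (eqVneq (t 15 0) 0) => t15; last first.
  rewrite den_pifnot_true //; split=> //; move: ht; case: ifP => // _.
  by case=> [[h]|h]; [rewrite h eqxx in t15|right].
rewrite den_pifnot_false // den_pseq den_pseq0 den_pif.
rewrite (@terminalP n r T inp rb inp0 inp_T rbE t j0 (Ordinal kn)) //.
move: ht; case: ifP => h15; first by case; rewrite t15.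
case=> [[_ t1 tT]|[]]; last by rewrite t15.
case: (boolP (Ordinal kn \in T j0)) => kT; last first.
  rewrite /=; split=> //; rewrite h15; left; split=> // x.
  rewrite ltnS leq_eqVlt => /orP[/eqP xk|]; last exact: tT.
  by have -> : x = Ordinal kn by apply: val_inj.
rewrite [_ != 0]/= 2!den_pseq den_pseq0.
split; [by rewrite /= !update_other|by rewrite /= !update_other|].
rewrite h15; right; split; first by [].
by exists (Ordinal kn) => // i; rewrite /= /update /= tk t1.
Qed.

End Fallback.

(** * The algorithm *)

Definition boosting : prg :=
  pseq [:: row_table; spacing; tour; unite; walk; round_robin try_select;
    capacities; init_flow; round_robin try_send; fallback].

Lemma boosting_wf : wf boosting.
Proof. by []. Qed.

Section Correct.
Variables (n r : nat) (e : rel 'I_n) (T : 'I_r -> {set 'I_n}) (a b : nat).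
Hypotheses (e_sym : symmetric e) (e_irr : irreflexive e).
Hypothesis e_conn : forall x y : 'I_n, connect e x y.
Hypotheses (n_gt0 : 0 < n) (r_gt0 : 0 < r).
Variable inp : nat -> nat.
Hypotheses (inp0 : inp 0 = n) (inp1 : inp 1 = r) (inp2 : inp 2 = a) (inp3 : inp 3 = b).
Hypothesis inp_e : forall u v : 'I_n, inp (4 + (u * n + v)) = e u v.
Hypothesis inp_T : forall (j : 'I_r) (x : 'I_n),
  inp (4 + n * n + (j * n + x)) = (x \in T j).

Let TT := \bigcup_j T j.
Let ew (x y : 'I_n) : nat := e x y.

Hypothesis b_gt0 : 0 < b.
Hypothesis T_linked : forall m (A : {set 'I_n}), b <= m * a \/ m = n ->
  minn #|A :&: TT| #|~: A :&: TT| <= m * cut ew A.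

Lemma count_card (L : seq 'I_n) (B : {set 'I_n}) :
  uniq L -> (forall v, v \in L) -> count (mem B) L = #|B|.
Proof.
move=> uL all; rewrite -size_filter -(card_uniqP (filter_uniq (mem B) uL)).
by apply: eq_card => v; rewrite mem_filter all andbT.
Qed.

Lemma spaced_half (x : 'I_n) p m (S : {set 'I_n}) : 0 < m ->
  uniq (x :: p) -> (forall v, v \in x :: p) ->
  (forall A : {set 'I_n}, exits A x p <= #|edges_between e A (~: A)|) ->
  spaced S TT m (x :: p) ->
  (forall A : {set 'I_n}, minn #|A :&: TT| #|~: A :&: TT| <= m * cut ew A) ->
  forall A : {set 'I_n},
    (#|A :&: S| <= 2 * cut ew A) || (#|~: A :&: S| <= 2 * cut ew A).
Proof.
move=> m0 uL all ex sp lk.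
have half A : #|A :&: TT| <= m * cut ew A -> #|A :&: S| <= 2 * cut ew A.
  move=> hA; have := spaced_exits A sp; rewrite !count_card //.
  have := ex A; rewrite card_edges_between -/(cut _ _) -/ew => exA.
  move=> h; have : m * #|A :&: S| <= m * cut ew A + m * cut ew A.
    apply: leq_trans (leq_trans (leq_addr _ _) h) _.
    by apply: leq_add => //; rewrite leq_pmul2l.
  by rewrite -mulnDr leq_pmul2l // addnn mul2n.
move=> A; have := lk A; rewrite geq_min => /orP[/half->//|h].
have cC : cut ew (~: A) = cut ew A by apply: cut_setC => x' y'; rewrite /ew e_sym.
by rewrite -cC half ?orbT // cC.
Qed.

Lemma boostingP (s : store) (j0 : 'I_r) : nat_of_ord j0 = 0 ->
  s 0 = inp -> (forall k i, k != 0 -> s k i = 0) ->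
  let X j := [set x : 'I_n | den boosting s 1 (j * n + x) != 0] in
  exists2 m, m = 0 \/ m.-1 * a < b &
  [/\ forall j : 'I_r, X j \subset T j,
      forall i j : 'I_r, i != j -> [disjoint X i & X j],
      forall A : {set 'I_n},
        minn #|A :&: \bigcup_(j < r) X j| #|~: A :&: \bigcup_(j < r) X j| <= cut ew A,
      forall j : 'I_r, #|T j| <= 171 * m * r ^ 2 * #|X j|.+1 &
      T j0 != set0 -> (exists j : 'I_r, X j != set0)].
Proof.
move=> j00 s0 sz; rewrite /boosting 10!den_pseq den_pseq0.
set s1 := den row_table s.
have s1z k i : k \notin [:: 0; 3; 20; 34] -> s1 k i = 0.
  rewrite !inE !negb_or => /and4P[k0 h1 h2 h3].
  by rewrite /s1 den_frame ?sz // /= !inE !negb_or h1 h2 h3.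
have s10 : s1 0 = inp by rewrite /s1 den_frame.
have rbE : forall u, u <= n \/ u < r -> s1 3 u = u * n by exact: (row_tableP inp0 inp1 s0).
clearbody s1; set s2 := den spacing s1.
have f2 k : k \notin [:: 20; 21; 34] -> s2 k = s1 k.
  by move=> h; rewrite /s2 den_frame //; move: h; rewrite /= !inE !negb_or => /and3P[-> -> ->].
have [mn mb mlt] : [/\ s2 21 0 <= n, b <= s2 21 0 * a \/ s2 21 0 = n & s2 21 0 = 0 \/ (s2 21 0).-1 * a < b].
  by apply: (spacingP inp0 inp2 inp3 s10).
clearbody s2; set m := s2 21 0 in mn mb mlt *.
have m0 : 0 < m.
  by case: mb => [h|->//]; rewrite lt0n; apply: contraTneq h => ->; rewrite mul0n -ltnNge.
set s3 := den tour s2.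
have f3 k : k \notin [:: 2; 23] -> k \notin writes tour -> s3 k = s2 k.
  by move=> h1 h2; rewrite /s3 den_frame.
have [s32 [x [p [x0 uL all pp ex]]]] : (forall u v : 'I_n, entries (s3 2) u v = e u v) /\
  exists x p, [/\ nat_of_ord x = 0, uniq (x :: p), forall v, v \in x :: p,
    path (fun u v : 'I_n => s3 6 u == v) x p &
    forall A : {set 'I_n}, exits A x p <= #|edges_between e A (~: A)|].
  apply: (tourP e_sym e_conn n_gt0 inp0 inp_e); first by rewrite f2.
  by move=> u; rewrite f2 // rbE //; left; apply: ltnW.
have [g30 g33 g321] : [/\ s3 0 = inp, s3 3 = s1 3 & s3 21 = s2 21].
  by split; rewrite f3 // f2.
have s3z k i : k \notin [:: 0; 3; 20; 21; 34] -> k \notin writes tour -> s3 k i = 0.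
  move=> h1 h2; rewrite /s3 den_frame // f2 ?s1z //; move: h1; rewrite !inE !negb_or.
    by case/and5P=> -> -> -> _ ->.
  by case/and5P=> _ _ -> -> ->.
clearbody s3; set s4 := den unite s3.
have s4T (v : 'I_n) : s4 14 v = (v \in TT).
  apply: (uniteP inp0 inp1 inp_T) => //; first by move=> u hu; rewrite g33 rbE.
  by move=> w; apply: s3z.
have f4 k : k \notin [:: 34; 35; 14] -> s4 k = s3 k.
  by move=> h; rewrite /s4 den_frame.
clearbody s4; set s5 := den walk s4.
have [s57 s525] : (forall v : 'I_n, s5 7 v = rank TT (x :: p) v) /\
  s5 25 0 = count (mem TT) (x :: p).
  apply: (walkP inp0 (T := T)) => //; first by rewrite (f4 0).
  by rewrite (f4 6).
have f5 k : k \notin [:: 24; 25; 34; 7] -> s5 k = s4 k.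
  move=> h; rewrite /s5 den_frame //; move: h; rewrite /= !inE !negb_or.
  by case/and4P=> -> -> -> ->.
clearbody s5; set s6 := den (round_robin try_select) s5.
have [Y [l1 l2 l3 l4 l5] bY] : exists2 Y,
    selected T (s5 7) m (count (mem TT) (x :: p)) (s6 8) Y &
    forall j, #|T j| <= m + 2 * m * (r * #|Y j|.+1).
  apply: (@selectP n r T inp (s1 3)) => //.
  - by move=> u v uT vT; rewrite !s57; apply: rank_inj.
  - by move=> u uT; rewrite s57; apply: rank_lt_count.
  - by rewrite f5 // f4.
  - by rewrite f5 // f4.
  - by rewrite f5 // f4 // g321.
  by move=> w; rewrite f5 // f4 // s3z.
have f6 k : k \notin writes (round_robin try_select) -> s6 k = s5 k.
  by move=> h; rewrite /s6 den_frame.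
have [g60 g63 g62] : [/\ s6 0 = inp, s6 3 = s1 3 & s6 2 = s3 2].
  by split; rewrite f6 // f5 // f4.
have s6z k i : k \in [:: 1; 15] -> s6 k i = 0.
  by rewrite !inE => /orP[/eqP->|/eqP->]; rewrite f6 // f5 // f4 // s3z.
clearbody s6; set s7 := den capacities s6.
have rbE' (u : 'I_n) : s1 3 u = u * n by rewrite rbE //; left; apply: ltnW.
have s7c : forall u v : 'I_n, entries (s7 13) u v = capacity e u v.
  apply: (capacitiesP e_sym e_irr inp0 rbE' g60 g63) => u v.
  by rewrite g62.
have f7 k : k \notin writes capacities -> s7 k = s6 k by move=> h; rewrite /s7 den_frame.
have [g70 g73 g78] : [/\ s7 0 = inp, s7 3 = s1 3 & s7 8 = s6 8] by split; rewrite f7.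
have s7z k i : k \in [:: 1; 15] -> s7 k i = 0.
  by rewrite !inE => /orP[/eqP->|/eqP->]; rewrite f7 // s6z.
clearbody s7; set s8 := den init_flow s7.
pose S := \bigcup_j Y j.
have s8f : flow_at (capacity e) S s8 (fun _ => 0).
  apply: (init_flowP inp0 rbE' g70 g73 s7c) => w; rewrite g78.
  apply/bigcupP/idP => [[j _]|hw]; first by rewrite l1 => /eqP->.
  have lr : (s6 8 w).-1 < r by have := l2 w; move: hw; clear; lia.
  by exists (Ordinal lr) => //; rewrite l1 /=; move: hw; clear; lia.
have f8 k : k \notin writes init_flow -> s8 k = s7 k by move=> h; rewrite /s8 den_frame.
have [g80 g83 g88] : [/\ s8 0 = inp, s8 3 = s1 3 & s8 8 = s6 8] by split; rewrite f8.
have s8z k i : k \in [:: 1; 15] -> s8 k i = 0.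
  by rewrite !inE => /orP[/eqP->|/eqP->]; rewrite f8 // s7z.
clearbody s8.
have lk (A : {set 'I_n}) : minn #|A :&: TT| #|~: A :&: TT| <= m * cut ew A by apply: T_linked.
have ST : S \subset TT.
  by apply/subsetP => v /bigcupP[j _ vj]; apply/bigcupP; exists j => //; apply: (subsetP (l3 j)).
have sp : spaced S TT m (x :: p).
  apply: spaced_rank => //.
    by move=> v /bigcupP[j _ vj]; rewrite -s57; apply: l4 vj.
  move=> u v /bigcupP[i _ ui] /bigcupP[j _ vj] uv; rewrite -!s57.
  have := l5 _ _ _ _ ui vj uv; rewrite /close => hc.
  by apply/negPn/negP; rewrite negb_or -!ltnNge => /andP[h1 h2]; apply: hc.
have S_half := spaced_half m0 uL all ex sp lk.
have c_nb := capacity_nonbridge e_conn.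
have bound (U Z : {set 'I_n}) :
  (forall A : {set 'I_n}, 3 * #|A :&: U| <= cut (capacity e) A + #|A :&: S|) -> Z \subset S ->
  (forall z, z \in Z -> z \notin U -> exists2 A : {set 'I_n}, z \in A &
     cut (capacity e) A + #|A :&: S| <= 3 * #|A :&: U| + 2) ->
  (#|S| <= #|Z| + 2 + 18 * #|U|) || (#|Z| <= 40 * #|U|).
  move=> hU ZS hZ; exact: (blocked_bound e_conn (capacity_sym e_sym) (capacity_bound e) c_nb S_half hU ZS hZ).
set s9 := den (round_robin try_send) s8.
have [X [[o1 o2 o3] hX [g90 g93]] bX] : exists2 X, [/\ sent Y (s9 1) (s9 15 0) X,
      forall A : {set 'I_n}, 3 * #|A :&: \bigcup_j X j| <= cut (capacity e) A + #|A :&: S| &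
      s9 0 = inp /\ s9 3 = s1 3] &
    forall j, #|Y j| <= 4 + 80 * (r * #|X j|.+1).
  apply: (send_allP inp0 inp1 rbE l1 bound g80 g83 g88 s8f).
  - by move=> i; apply: s8z.
  - exact: s8z.
clearbody s9.
have linkX A : minn #|A :&: \bigcup_j X j| #|~: A :&: \bigcup_j X j| <= cut ew A.
  by apply: (linked_of_flow e_sym (capacity_sym e_sym) (capacity_bound e) (@capacity_bridge _ e) S_half hX).
have size_bound j (Xj : {set 'I_n}) : #|X j| <= #|Xj| -> #|T j| <= 171 * m * r ^ 2 * #|Xj|.+1.
  move=> hXj; apply: leq_trans (bY j) _.
  apply: leq_trans (_ : m + 2 * m * (r * (5 + 80 * (r * #|Xj|.+1))) <= _).
    rewrite leq_add2l leq_mul2l leq_mul2l; apply/orP; right; apply/orP; right.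
    rewrite -[5]/(1 + 4) -addnA add1n ltnS; apply: leq_trans (bX j) _.
    by rewrite leq_add2l !leq_mul2l ltnS hXj !orbT.
  move: #|Xj| m0 r_gt0 => y m1 r1; clear -m1 r1.
  have r2 : 1 <= r ^ 2 by rewrite expn_gt0 r1.
  have rr : r <= r ^ 2 by rewrite -{1}[r]expn1 leq_pexp2l.
  have e1 : m * 1 <= m * (r ^ 2 * y.+1) by rewrite leq_mul2l muln_gt0 r2 orbT.
  have e2 : m * r <= m * (r ^ 2 * y.+1).
    by rewrite leq_mul2l (leq_trans rr) ?orbT // leq_pmulr.
  (* 171 = 1 + 10 + 160, with m and m * r both at most m * r^2 * (y + 1). *)
  have -> : m + 2 * m * (r * (5 + 80 * (r * y.+1))) =
     m * 1 + 10 * (m * r) + 160 * (m * (r ^ 2 * y.+1)).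
    by rewrite -mulnn; clear; lia.
  have -> : 171 * m * r ^ 2 * y.+1 = 171 * (m * (r ^ 2 * y.+1)) by rewrite -!mulnA.
  by move: e1 e2; clear; lia.
have Xdisj i j : i != j -> [disjoint X i & X j].
  move=> ij; rewrite -setI_eq0; apply/eqP/setP => y; rewrite !inE; apply/negP.
  case/andP=> /(subsetP (o2 i)) yi /(subsetP (o2 j)) yj.
  by case/eqP: ij; apply: (Y_disjoint l1 yi yj).
have := fallbackP inp0 inp_T rbE j00 g90 g93.
set s10' := den fallback s9; cbv zeta; move: s10' => t.
pose X' (j : 'I_r) := [set x : 'I_n | t 1 (j * n + x) != 0].
case: ifP => [any ht|any].
  have XE j : X' j = X j by apply/setP => y; rewrite inE ht o1.
  exists m => //; rewrite -!/(X' _); split.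
  - by move=> j; rewrite -/(X' j) XE; apply: subset_trans (o2 j) (l3 j).
  - by move=> i j ij; rewrite -/(X' i) -/(X' j) !XE; apply: Xdisj.
  - move=> A; have -> : \bigcup_(j < r) X' j = \bigcup_j X j by apply: eq_bigr => j _.
    exact: linkX.
  - by move=> j; rewrite -/(X' j); apply: size_bound; rewrite XE.
  move=> _; move: any; rewrite o3 => /set0Pn[y /bigcupP[j _ yj]].
  by exists j; rewrite -/(X' j) XE; apply/set0Pn; exists y.
have X0 j : X j = set0.
  apply/eqP; move/negbFE: any; rewrite o3 -!subset0 => h; apply: subset_trans h.
  exact: bigcup_sup.
case=> [[ht T0]|[w wT ht]].
  have XE j : X' j = set0 by rewrite -(X0 j); apply/setP => y; rewrite inE ht o1.
  exists m => //; split.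
  - by move=> j; rewrite -/(X' j) XE sub0set.
  - by move=> i j ij; rewrite -/(X' i) -/(X' j) !XE -setI_eq0 setI0.
  - move=> A; have -> : \bigcup_(j < r) X' j = set0 by apply: big1 => j _.
    by rewrite !setI0 cards0.
  - by move=> j; rewrite -/(X' j); apply: size_bound; rewrite XE X0.
  by rewrite T0 eqxx.
have XE j : X' j = if j == j0 then [set w] else set0.
  apply/setP => y; rewrite inE ht.
  have -> : (j * n + y == w) = (j == j0) && (y == w).
    have -> : nat_of_ord w = j0 * n + w by rewrite j00.
    by rewrite index_eq.
  have -> : s9 1 (j * n + y) = 0 by apply/eqP; rewrite -[_ == _]negbK -o1 X0 inE.
  by case: (j == j0) => /=; rewrite !inE //; case: (y == w).
exists m => //; split.
- move=> j; rewrite -/(X' j) XE; case: eqP => [->|_]; last exact: sub0set.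
  by rewrite sub1set.
- move=> i j ij; rewrite -/(X' i) -/(X' j) !XE -setI_eq0.
  case: (altP (i =P j0)) => [i0|_]; last by rewrite set0I.
  by case: (altP (j =P j0)) => [j1|_]; rewrite ?setI0 //; rewrite i0 j1 eqxx in ij.
- move=> A; have -> : \bigcup_(j < r) X' j = [set w].
    rewrite (bigD1 j0) //= XE eqxx big1 ?setU0 // => j /negPf h.
    by rewrite -/(X' j) XE h.
  have [wA|wA] := boolP (w \in A).
    have -> : ~: A :&: [set w] = set0.
      by apply/setP => y; rewrite !inE; case: eqP => [->|]; rewrite ?wA ?andbF.
    by rewrite cards0 minn0.
  have -> : A :&: [set w] = set0.
    by apply/setP => y; rewrite !inE; case: eqP => [->|]; rewrite ?(negPf wA) ?andbF.
  by rewrite cards0 min0n.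
- by move=> j; rewrite -/(X' j); apply: size_bound; rewrite X0 cards0.
by move=> _; exists j0; rewrite -/(X' j0) XE eqxx; apply/set0Pn; exists w; rewrite inE.
Qed.

End Correct.

(** * The theorem *)

Lemma nth_allpairs (A B C : Type) (f : A -> B -> C) x0 y0 z0 (s : seq A) (t : seq B) i j :
  i < size s -> j < size t ->
  nth z0 [seq f x y | x <- s, y <- t] (i * size t + j) = f (nth x0 s i) (nth y0 t j).
Proof.
move=> + jt; elim: s i => //= x s IHs [|i] si.
  by rewrite mul0n add0n nth_cat size_map jt (nth_map y0).
rewrite nth_cat size_map mulSn -addnA ltnNge leq_addr /= addKn.
exact: IHs.
Qed.

Section Encode.
Variables (n r : nat) (e : rel 'I_n) (T : 'I_r -> {set 'I_n}) (q : rat).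

Let inp := nth 0 (encode e T q).

Lemma encode_edge (u v : 'I_n) : inp (4 + (u * n + v)) = e u v.
Proof.
rewrite /inp /encode nth_cat /= addKn nth_cat size_allpairs size_enum_ord.
have -> : u * n + v < n * n.
  by have := ltn_ord u; have := ltn_ord v; nia.
rewrite -{1}[X in u * X](size_enum_ord n) (nth_allpairs _ u v) ?size_enum_ord //.
by rewrite !nth_ord_enum.
Qed.

Lemma encode_terminal (j : 'I_r) (x : 'I_n) : inp (4 + n * n + (j * n + x)) = (x \in T j).
Proof.
rewrite /inp /encode -addnA nth_cat /= addKn nth_cat size_allpairs size_enum_ord.
rewrite ltnNge leq_addr /= addKn.
rewrite -{1}[X in j * X](size_enum_ord n) (nth_allpairs _ j x) ?size_enum_ord //.
by rewrite !nth_ord_enum.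
Qed.

Lemma encode_size : n * n + r * n <= input_size (encode e T q).
Proof.
apply: leq_trans (_ : size (encode e T q) <= _).
  by rewrite /encode /= !size_cat !size_allpairs !size_enum_ord; lia.
by rewrite /input_size -sum1_size; apply: leq_sum.
Qed.

End Encode.

(** * The constants, over the reals *)

Section Real.
Import Order.TTheory GRing.Theory Num.Theory.
Local Open Scope ring_scope.
Variable R : realType.

(** exp(-1/2) >= 1 - 1/2 gives exp(1/2) <= 2. *)
Lemma ln_ge_half (r : nat) : (1 < r)%N -> 1 / 2 <= ln (r%:R : R).
Proof.
move=> r1; have r0 : (0 : R) < r%:R by rewrite ltr0n ltnW.
rewrite -ler_expR lnK ?posrE //.
apply: (@le_trans _ _ 2); last by rewrite ler_nat.
have := expR_ge1Dx (- (1 / 2) : R); rewrite expRN => h.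
have p := expR_gt0 (1 / 2 : R).
rewrite -[X in X <= _]invrK -[X in _ <= X]invrK lef_pV2 ?posrE ?invr_gt0 //; lra.
Qed.

Variables (q : rat) (alpha : R).
Hypotheses (alpha_gt0 : 0 < alpha) (alpha_lt1 : alpha < 1).
Hypotheses (alpha_q : alpha / 2 <= ratr q) (q_alpha : ratr q <= alpha).

Lemma ratr_fraction : ratr q = `|numq q|%N%:R / `|denq q|%N%:R :> R.
Proof.
have q0 : 0 < q by rewrite -(ltr0q R); apply: lt_le_trans alpha_q; rewrite divr_gt0.
rewrite /ratr -(absz_denq q) -{1}(gtz0_abs (_ : 0 < numq q)) ?numq_gt0 //.
Qed.

Lemma denq_gt0N : (0 < `|denq q|)%N.
Proof. by rewrite absz_gt0 denq_neq0. Qed.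

Lemma linked_fraction (k l : nat) : alpha * k%:R <= l%:R ->
  (k * `|numq q| <= l * `|denq q|)%N.
Proof.
move=> h; rewrite -(ler_nat R) !natrM -ler_pdivrMr ?ltr0n ?denq_gt0N //.
rewrite -mulrA -ratr_fraction mulrC; apply: le_trans h.
by rewrite ler_wpM2r.
Qed.

(** Minimality of m and q >= alpha / 2 give (m - 1) * alpha < 2; the last alpha is below 1. *)
Lemma spacing_le m : m = 0%N \/ (m.-1 * `|numq q| < `|denq q|)%N -> m%:R * alpha <= 3.
Proof.
case=> [->|]; first by rewrite mul0r.
case: m => [|m]; first by rewrite mul0r.
rewrite /= -(ltr_nat R) natrM -[X in _ < X]mul1r -ltr_pdivrMr ?ltr0n ?denq_gt0N // -mulrA -ratr_fraction => h.
have : m%:R * (alpha / 2) < 1 by apply: le_lt_trans h; rewrite ler_wpM2l.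
rewrite -(natr1 m) mulrDl mul1r mulrA; move: alpha_lt1.
by set y := _ * alpha; lra.
Qed.

(** Here 513 = 3 * 171, and for x > 0 the step from x + 1 to 2 x doubles it to 1026. For x = 0 and r
    > 1, the constant 2052 with ln r >= 1/2 forces alpha * k >= 1026 r^2, more than the 513 r^2
    allowed; r = 1 is left to the last premise. *)
Lemma boosted_size (r k m x : nat) : (0 < r)%N ->
  m%:R * alpha <= 3 -> (k <= 171 * m * r ^ 2 * x.+1)%N ->
  2052 * r%:R ^+ 2 * ln r%:R / alpha <= k%:R -> (r = 1%N -> x = 0%N -> k = 0%N) ->
  1 / 1026 * (alpha / r%:R ^+ 2) * k%:R <= x%:R.
Proof.
move=> r0 hm hk hc h1.
have rp : (0 : R) < r%:R ^+ 2 by rewrite exprn_gt0 // ltr0n.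
have ak : alpha * k%:R <= 513 * r%:R ^+ 2 * x.+1%:R.
  have := hk; rewrite -(ler_nat R) !natrM -expr2 => hk'.
  apply: (@le_trans _ _ (alpha * (171 * m%:R * r%:R ^+ 2 * x.+1%:R))).
    by rewrite ler_wpM2l // ltW.
  have -> : alpha * (171 * m%:R * r%:R ^+ 2 * x.+1%:R) =
    (m%:R * alpha) * (171 * r%:R ^+ 2 * x.+1%:R) by ring.
  have -> : 513 * r%:R ^+ 2 * x.+1%:R = 3 * (171 * r%:R ^+ 2 * x.+1%:R) :> R by ring.
  by rewrite ler_wpM2r // !mulr_ge0 // ltW.
have -> : 1 / 1026 * (alpha / r%:R ^+ 2) * k%:R = (alpha * k%:R / 1026) / r%:R ^+ 2 by ring.
rewrite ler_pdivrMr //.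
case: x => [|x] in hk ak h1 *; last first.
  have : (x.+2%:R : R) <= 2 * x.+1%:R by rewrite -natrM ler_nat mul2n -addnn -[x.+2]addn1 leq_add2l.
  move=> hx; have : 513 * r%:R ^+ 2 * x.+2%:R <= 513 * r%:R ^+ 2 * (2 * x.+1%:R) :> R.
    by rewrite ler_wpM2l // mulr_ge0 // ltW.
  by move: ak; lra.
move: r0; rewrite leq_eqVlt => /orP[/eqP r1|r1].
  by rewrite h1 // mulr0 !mul0r.
have := ln_ge_half r1 => hln.
move: hc; rewrite ler_pdivrMr // => hc.
have : 2052 * r%:R ^+ 2 * (1 / 2) <= 2052 * r%:R ^+ 2 * ln r%:R :> R.
  by rewrite ler_wpM2l // mulr_ge0 // ltW.
by move: ak; lra.
Qed.

End Real.

Import Order.TTheory GRing.Theory Num.Theory.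
Local Open Scope ring_scope.

Theorem theorem3 (R : realType) :
  exists c C : R, 0 < c /\ 0 < C /\
  forall d : nat, exists (prog : com) (p : {poly nat}),
  forall (n r k1 k2 : nat) (e : rel 'I_n) (T : 'I_r -> {set 'I_n})
         (alpha : R) (q : rat),
    simple_graph e ->
    connected_graph e ->
    (forall x : 'I_n, (degree e x <= 4)%N) ->
    (0 < r)%N ->
    0 < alpha -> alpha < 1 ->
    well_linked e alpha (\bigcup_j T j) ->
    (forall j : 'I_r, #|T j| = if val j == 0%N then k1 else k2) ->
    c * r%:R ^+ 2 * ln r%:R / alpha <= k1%:R ->
    c * r%:R ^+ 2 * ln r%:R / alpha <= k2%:R ->
    alpha / 2 <= ratr q -> ratr q <= alpha ->
    let input := encode e T q in
    let t := p.[input_size input] in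
    (forall w : t.-tuple bool, halted (run prog input w)) /\
    1 - 1 / n%:R ^+ d
      <= coin_prob R (fun w : t.-tuple bool =>
           good_output C alpha e T (decode n r (run prog input w))).
Proof.
exists 2052, (1 / 1026); split; first by lra.
split; first by lra.
move=> d; have [P HP] := time_poly boosting.
(* The success probability is 1, so one program and one polynomial serve all [d]. *)
exists (compile boosting), P.
move=> n r k1 k2 e T alpha q [e_sym e_irr] [n0 e_conn] _ r0 a0 a1 wl cT ck1 ck2 aq qa.
rewrite card_ord in n0; cbv zeta; set input := encode e T q.
have runE (w : P.[input_size input].-tuple bool) :
    run (compile boosting) input w = Config [::] (den boosting (init_store input)) w.
  apply: (@run_compile boosting input (input_size input) _ w boosting_wf); last by rewrite HP.
  (* As n > 0, n and r are at most n * n and r * n, the numbers of entries of the two tables. *)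
  have := encode_size e T q; rewrite -/input => hs [|[|//]] _ /=.
    by apply: leq_trans hs; apply: leq_trans (leq_addr _ _); rewrite leq_pmull.
  by apply: leq_trans hs; apply: leq_trans (leq_addl _ _); rewrite leq_pmulr.
split=> [w|]; first by rewrite runE.
have lk m (A : {set 'I_n}) : (`|denq q| <= m * `|numq q|)%N \/ m = n ->
    (minn #|A :&: \bigcup_j T j| #|~: A :&: \bigcup_j T j|
       <= m * cut (fun x y => e x y : nat) A)%N.
  move/forallP: wl => /(_ A); rewrite card_edges_between -/(cut _ _).
  set k := minn _ _; set l := cut _ _ => hkl [hm|->].
    have h := linked_fraction a0 aq qa hkl.
    rewrite -(leq_pmul2r (denq_gt0N q)); apply: leq_trans (leq_mul (leqnn k) hm) _.
    by rewrite mulnCA -mulnA leq_mul2l h orbT.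
  (* For m = n: if both sides contain terminals, connectivity gives a cut edge, and the minimum is
     at most n. *)
  case: (posnP k) => [->//|k0].
  have {k0} [kA kC] : (0 < #|A :&: \bigcup_j T j|)%N /\ (0 < #|~: A :&: \bigcup_j T j|)%N.
    by move: k0; rewrite /k leq_min => /andP.
  have l0 : (0 < l)%N.
    apply: (cut_gt0 e_conn); first by apply: contraTneq kA => ->; rewrite set0I cards0.
    by apply: contraTneq kC => ->; rewrite setCT set0I cards0.
  apply: leq_trans (geq_minl _ _) _; apply: leq_trans (max_card _) _.
  by rewrite card_ord leq_pmulr.
pose j0 := Ordinal r0.
have := @boostingP n r e T `|numq q| `|denq q| e_sym e_irr e_conn n0 r0 (nth 0%N input)
  erefl erefl erefl erefl (encode_edge e T q) (encode_terminal e T q) (denq_gt0N q) lk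
  (init_store input) j0 erefl erefl.
case=> [k i /negPf k0|m hm [Xsub Xdis Xlink Xsize Xne]]; first by rewrite /init_store k0.
set s := den boosting (init_store input) in Xsub Xdis Xlink Xsize Xne.
have mle := spacing_le a0 a1 aq hm.
have good (w : P.[input_size input].-tuple bool) : good_output (1 / 1026) alpha e T (decode n r (run (compile boosting) input w)).
  have -> : decode n r (run (compile boosting) input w) =
     (fun j : 'I_r => [set x : 'I_n | s 1%N (j * n + x)%N != 0%N]) by rewrite runE.
  apply/and4P; split.
  - by apply/forallP => j; apply: Xsub.
  - by apply/forallP => i; apply/forallP => j; apply/implyP => ij; apply: Xdis.
  - apply/forallP => j; apply: (boosted_size a0 r0 mle (Xsize j)).
      by rewrite cT; case: ifP.
    (* For r = 1 the set known to be nonempty can only be the one with index [j0]. *)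
    move=> r1 X0; have jj (i : 'I_r) : i = j0.
      by apply: val_inj => /=; have := ltn_ord i; move: r1; clear; lia.
    apply/eqP; rewrite cards_eq0; apply/negPn/negP; rewrite (jj j) => /Xne[i].
    by rewrite (jj i) -(jj j) -cards_eq0 X0.
  apply/forallP => A; rewrite mul1r ler_nat card_edges_between -/(cut _ _).
  exact: Xlink.
have -> : coin_prob R (fun w : P.[input_size input].-tuple bool =>
   good_output (1 / 1026) alpha e T (decode n r (run (compile boosting) input w))) = 1.
  rewrite /coin_prob (_ : [set w | _] = setT); last first.
    by apply/setP => w; rewrite !inE; apply: good.
  by rewrite cardsT card_tuple card_bool natrX divff // expf_neq0 ?pnatr_eq0.
by rewrite lerBlDr lerDl divr_ge0 // exprn_ge0.
Qed.
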